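(* Let $K$ be a field and let $G$ be a finite simple graph without isolated vertices, with vertex set $\{1,\ldots,n\}$ and $m$ edges, such that its edge ideal $I(G)$ has a linear resolution. Let $[e_1,\ldots,e_m]$ be an ordering of the edges of $G$ such that $[M_{e_1},\ldots,M_{e_m}]$ is a linear quotient ordering for $I(G)$. Let $I_G\subseteq K[y_1,\ldots,y_m]$ be the toric ideal of $G$, where $y_i$ corresponds to $e_i$, and let $\tau$ be the lexicographic order on $K[y_1,\ldots,y_m]$ such that $y_1\prec_\tau y_2\prec_\tau\cdots\prec_\tau y_m$. Then the reduced Gröbner basis of $I_G$ with respect to $\tau$ does not contain any binomial corresponding to a primitive walk of type (iii). In particular, it consists entirely of circuits of $I_G$, and hence $I_G$ is generated by circuits.
   Context: For an edge $e=\{i,j\}$ of $G$, the edge monomial is $M_e=x_ix_j\in S:=K[x_1,\ldots,x_n]$. The edge ideal is $I(G)=(M_{e_1},\ldots,M_{e_m})\subseteq S$. The toric ideal $I_G$ is the kernel of the surjective $K$-algebra homomorphism $K[y_1,\ldots,y_m]\to K[M_{e_1},\ldots,M_{e_m}]$, $y_i\mapsto M_{e_i}$; write $y_e$ for the variable mapped to $M_e$. A graded ideal $I\subseteq S$ generated in degree $d$ has a linear resolution if $\operatorname{Tor}^S_i(I,K)_j=0$ for all $i\ge 0$ and all $j\neq i+d$. If $I$ is minimally generated by $f_1,\ldots,f_s$ and for every $1<i\le s$ the ideal $(f_1,\ldots,f_{i-1}):_S(f_i)$ is generated by elements of degree $1$, then $[f_1,\ldots,f_s]$ is called a linear quotient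 ordering for $I$. A Gröbner basis is reduced if its elements are monic, its leading terms minimally generate the initial ideal, and no trailing term of its elements lies in the initial ideal. The support of a nonzero binomial $b=u-v\in I_G$ ($u,v$ monomials) is the set $\operatorname{supp}(b)$ of variables appearing in $u$ or in $v$. A binomial $b\in I_G$ is a circuit if it is irreducible and there is no nonzero binomial $b'\in I_G$ with $\operatorname{supp}(b')\subsetneq\operatorname{supp}(b)$. A walk of $G$ is a sequence of (possibly repeated) consecutive edges $\{v_0\to v_1\to\cdots\to v_q\}$; it is closed if $v_0=v_q$, and even (odd) if $q$ is even (odd). A path is a walk with all vertices distinct; a cycle is a closed walk of length $q\ge 3$ with $v_0,\ldots,v_{q-1}$ all distinct. To an even closed walk $\Gamma=\{v_0\to v_1\to\cdots\to v_{2q}=v_0\}$ one associates the binomial $b_\Gamma=\prod_{i=1}^q y_{\{v_{2i-2},v_{2i-1}\}}-\prod_{i=1}^q y_{\{v_{2i-1},v_{2i}\}}\in I_G$, considered up to sign. A subwalk of $\Gamma$ is an even closed walk $\Gamma'$ whose even-position edges are (with multiplicity) even-position edges of $\Gamma$ and whose odd-position edges are (with multiplicity) odd-position edges of $\Gamma$; it is proper if it is nonempty and has fewer edges than $\Gamma$. An even closed walk $\Gamma$ with $b_\Gamma\ne 0$ is primitive if it has no proper subwalk. A primitive walk is of type (iii) if, up to the choice of its starting point, it has the form $\{C_1,p_1,C_2,p_2,\ldots,C_h,p_h\}$ where the $p_i$ are paths of length at least one and the $C_i$ are odd cycles such that $C_i$ and $C_{i+1}$ are vertex-disjoint for every $i$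 (indices modulo $h$). *)

(* Defs.v *)
From mathcomp Require Import all_boot all_order all_algebra.
From mathcomp Require Export mpoly.

Set Implicit Arguments.
Unset Strict Implicit.
Unset Printing Implicit Defensive.

Import GRing.Theory.
Local Open Scope ring_scope.

Section Ideals.
Variable R : comNzRingType.
Implicit Types (A I : R -> Prop) (f p : R).

Definition ideal_gen A : R -> Prop := fun p =>
  exists s : seq (R * R),
    (forall x, x \in s -> A x.2) /\ p = \sum_(x <- s) x.1 * x.2.

Definition colon_ideal I f : R -> Prop := fun p => I (p * f).

Definition minimally_generates I (A : R -> Prop) : Prop :=
  (forall p, I p <-> ideal_gen A p)
  /\ (forall f, A f -> ~ ideal_gen (fun g => A g /\ g <> f) f).

End Ideals.

Definition irreducible (R : unitRingType) (p : R) : Prop :=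
  [/\ p != 0, p \isn't a GRing.unit
    & forall a b : R, p = a * b -> a \is a GRing.unit \/ b \is a GRing.unit].

Section Resolutions.
Variables (K : fieldType) (n : nat).
Local Notation S := {mpoly K[n]}.

(* The data of a complex ... -> F_1 -> F_0 -> S of free S-modules of finite
   rank.  Elements of F_i are row vectors, on which the matrices act from the
   right; the k-th basis vector of F_i sits in degree [fr_deg k].  *)
Record free_complex := FreeComplex {
  fr_rank : nat -> nat;
  fr_deg : forall i, 'I_(fr_rank i) -> nat;
  fr_diff : forall i, 'M[S]_(fr_rank i.+1, fr_rank i);
  fr_aug : 'cV[S]_(fr_rank 0)
}.

(* The first two clauses say that all maps are homogeneous of degree 0, the
   third that the image of the augmentation is I, the last two exactness. *)
Definition graded_free_resolution (F : free_complex) (I : S -> Prop) : Prop :=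
  [/\ forall i k l (u : 'X_{1..n}), u \in msupp (fr_diff F i k l) ->
        (mdeg u + fr_deg l)%N = fr_deg k,
      forall k (u : 'X_{1..n}), u \in msupp (fr_aug F k 0) -> mdeg u = fr_deg k,
      forall p, I p <-> exists v : 'rV[S]_(fr_rank F 0), p = (v *m fr_aug F) 0 0,
      forall v : 'rV[S]_(fr_rank F 0),
        v *m fr_aug F = 0 <-> exists w, v = w *m fr_diff F 0
    & forall i (v : 'rV[S]_(fr_rank F i.+1)),
        v *m fr_diff F i = 0 <-> exists w, v = w *m fr_diff F i.+1].

(* The differential of F (x)_S K, where K = S / (x_1, ..., x_n): every entry
   is replaced by its constant coefficient. *)
Definition fr_diffK (F : free_complex) i : 'M[K]_(fr_rank F i.+1, fr_rank F i) :=
  map_mx (mcoeff 0%MM) (fr_diff F i).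

Definition fr_cycleK (F : free_complex) i : 'rV[K]_(fr_rank F i) -> Prop :=
  match i with
  | 0 => fun=> True
  | i'.+1 => fun v => v *m fr_diffK F i' = 0
  end.

Definition fr_in_degree (F : free_complex) i (j : nat)
    (v : 'rV[K]_(fr_rank F i)) : Prop :=
  forall k, v 0 k != 0 -> fr_deg k = j.

(* H_i(F (x)_S K)_j = 0 *)
Definition homologyK_vanishes (F : free_complex) (i j : nat) : Prop :=
  forall v : 'rV[K]_(fr_rank F i), fr_in_degree j v -> fr_cycleK v ->
    exists2 w : 'rV[K]_(fr_rank F i.+1), fr_in_degree j w & v = w *m fr_diffK F i.

(* Tor_i^S(I, K)_j = 0; the homology does not depend on the resolution. *)
Definition Tor_vanishes (I : S -> Prop) (i j : nat) : Prop :=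
  exists2 F : free_complex, graded_free_resolution F I & homologyK_vanishes F i j.

(* Degrees j < 0 need no mention: I, hence Tor_i^S(I, K), vanishes there. *)
Definition linear_resolution (d : nat) (I : S -> Prop) : Prop :=
  (exists2 A : S -> Prop, (forall f, A f -> f \is d.-homog)
                        & (forall p, I p <-> ideal_gen A p))
  /\ (forall i j, j <> (i + d)%N -> Tor_vanishes I i j).

Definition has_linear_resolution (I : S -> Prop) : Prop :=
  exists d, linear_resolution d I.

Definition linear_quotient_ordering s (I : S -> Prop) (f : s.-tuple S) : Prop :=
  [/\ injective (tnth f), minimally_generates I (fun g => g \in f)
    & forall i : 'I_s, (0 < i)%N ->
        exists2 A : S -> Prop, (forall g, A g -> g \is 1.-homog)
        & forall p,
            colon_ideal (ideal_gen (fun g => exists2 j : 'I_s, (j < i)%N & g = tnth f j))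
                        (tnth f i) p
            <-> ideal_gen A p].

End Resolutions.

(* Lexicographic order with X_0 < X_1 < ... < X_(m-1): the largest variable
   is the one of largest index. *)
Definition lex_lt m : rel 'X_{1..m} := fun u v =>
  [exists i : 'I_m, (u i < v i)%N && [forall j : 'I_m, (i < j)%N ==> (u j == v j)]].

Section Groebner.
Variables (K : fieldType) (m : nat).
Local Notation T := {mpoly K[m]}.
Variable lt : rel 'X_{1..m}.

Definition is_lead (p : T) (u : 'X_{1..m}) : Prop :=
  u \in msupp p /\ (forall v, v \in msupp p -> v != u -> lt v u).

Definition initial_ideal (I : T -> Prop) : T -> Prop :=
  ideal_gen (fun t => exists f u, [/\ I f, is_lead f u & t = 'X_[u]]).

(* All elements of B being monic, their leading terms are the X^u with u the
   leading monomial. *)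
Definition reduced_groebner_basis (I : T -> Prop) (B : seq T) : Prop :=
  [/\ forall g, g \in B -> I g,
      forall g, g \in B -> exists2 u, is_lead g u & g@_u = 1,
      minimally_generates (initial_ideal I)
        (fun t => exists g u, [/\ g \in B, is_lead g u & t = 'X_[u]]),
      forall g h u, g \in B -> h \in B -> is_lead g u -> is_lead h u -> g = h
    & forall g u v, g \in B -> is_lead g u -> v \in msupp g -> v != u ->
        ~ initial_ideal I 'X_[v]].

End Groebner.

Section Circuits.
Variables (K : fieldType) (m : nat).
Local Notation T := {mpoly K[m]}.

Definition is_binomial (b : T) : Prop := exists u v, b = 'X_[u] - 'X_[v].

Definition bsupp (b : T) : {set 'I_m} :=
  [set k | has (fun u : 'X_{1..m} => u k != 0%N) (msupp b)].

Definition is_circuit (I : T -> Prop) (b : T) : Prop :=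
  [/\ is_binomial b, I b, irreducible b
    & ~ exists b', [/\ is_binomial b', b' != 0, I b' & bsupp b' \proper bsupp b]].

End Circuits.

Section Graphs.
Variables (K : fieldType) (n : nat) (adj : rel 'I_n).

Definition edge_set : {set {set 'I_n}} :=
  [set [set p.1; p.2] | p : 'I_n * 'I_n & adj p.1 p.2].

Definition edge_monomial (S : {set 'I_n}) : {mpoly K[n]} := \prod_(i in S) 'X_i.

Definition edge_ideal : {mpoly K[n]} -> Prop :=
  ideal_gen (fun f => exists2 S, S \in edge_set & f = edge_monomial S).

Variables (m : nat) (e : m.-tuple {set 'I_n}).

Definition toric_ideal : {mpoly K[m]} -> Prop :=
  fun p => comp_mpoly [tuple edge_monomial (tnth e k) | k < m] p = 0.

(* The variable y_S of an edge S; the product has exactly one factor when e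
   lists the edges without repetition. *)
Definition edge_var (S : {set 'I_n}) : {mpoly K[m]} :=
  \prod_(k < m | tnth e k == S) 'X_k.

(* A closed walk v_0 -> v_1 -> ... -> v_q = v_0 is represented by the sequence
   [:: v_0; ...; v_(q-1)], the return to v_0 being implicit.  Its length is the
   size of the sequence, and a change of starting point is a rotation. *)
Definition walk_edges (s : seq 'I_n) : seq {set 'I_n} :=
  [seq [set p.1; p.2] | p <- zip s (rot 1 s)].

(* Positions are numbered from 1, so the i-th entry of [walk_edges] (numbered
   from 0) is in odd position iff i is even. *)
Definition odd_position_edges (s : seq 'I_n) : seq {set 'I_n} :=
  [seq nth set0 (walk_edges s) i | i <- iota 0 (size s) & ~~ odd i].
Definition even_position_edges (s : seq 'I_n) : seq {set 'I_n} :=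
  [seq nth set0 (walk_edges s) i | i <- iota 0 (size s) & odd i].

Definition even_closed_walk (s : seq 'I_n) : bool :=
  cycle adj s && ~~ odd (size s).

Definition walk_binomial (s : seq 'I_n) : {mpoly K[m]} :=
  \prod_(S <- odd_position_edges s) edge_var S
  - \prod_(S <- even_position_edges s) edge_var S.

Definition subwalk (s' s : seq 'I_n) : Prop :=
  [/\ even_closed_walk s',
      forall S, (count_mem S (odd_position_edges s')
                 <= count_mem S (odd_position_edges s))%N
    & forall S, (count_mem S (even_position_edges s')
                 <= count_mem S (even_position_edges s))%N].

Definition primitive_walk (s : seq 'I_n) : Prop :=
  [/\ even_closed_walk s, walk_binomial s != 0
    & ~ exists s', [/\ subwalk s' s, s' != [::] & (size s' < size s)%N]].

Definition odd_cycle (s : seq 'I_n) : bool :=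
  [&& cycle adj s, uniq s, (3 <= size s)%N & odd (size s)].

(* The cycle C_i is x_i :: c_i, and the path p_i, from x_i to x_(i+1), has
   vertices x_i :: q_i; [ordS] is the successor modulo h, and [belast] drops
   the end point x_(i+1) of p_i, with which C_(i+1) starts. *)
Definition type_iii (s : seq 'I_n) : Prop :=
  exists (h : nat) (x : 'I_h -> 'I_n) (c q : 'I_h -> seq 'I_n) (k : nat),
  [/\ (0 < h)%N,
      forall i, odd_cycle (x i :: c i),
      forall i, [&& path adj (x i) (q i), uniq (x i :: q i),
                    last (x i) (q i) == x (ordS i) & (0 < size (q i))%N],
      forall i, [disjoint x i :: c i & x (ordS i) :: c (ordS i)]
    & s = rot k (flatten [seq (x i :: c i) ++ belast (x i) (q i) | i <- enum 'I_h])].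

End Graphs.

Arguments edge_monomial K {n} S.
Arguments edge_ideal K {n} adj _.
Arguments toric_ideal K {n m} e _.
Arguments edge_var K {n m} e S.
Arguments walk_binomial K {n m} e s.
Arguments primitive_walk K {n} adj {m} e s.

(* Main.v *)
(** Linear quotients say that for disjoint edges e_k, e_l some edge e_j with
    j < max(k, l) joins an end of e_k to an end of e_l.

    Let y^u - y^v be a binomial of I_G with leading monomial y^u, where y^u is
    a minimal generator of the initial ideal, and let E be the largest edge
    occurring in it.  Following edges of u and v alternately from E, one gets a
    closed walk that uses up u and v.  If an edge h smaller than E joins two
    vertices of the walk, a part of the walk through E, closed up by h, is a
    binomial whose leading monomial divides y^u; so that part contains all of
    u.  Odd closed subwalks may be traversed in either direction, which makes
    this constraint strong enough, together with the joining edges provided by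
    linear quotients, to show that at most one vertex is visited twice.  Hence
    the walk is an even cycle or two odd cycles sharing a vertex: its binomial
    is a circuit, and it is not of type (iii), where at least two vertices are
    visited twice.  Induction on the leading monomial then writes every binomial
    of I_G as a combination of such circuits. *)

Require Import Defs.
From mathcomp Require Import all_boot all_order all_algebra.
From mathcomp Require Import zify ring.

Set Implicit Arguments.
Unset Strict Implicit.
Unset Printing Implicit Defensive.

Import Order.TTheory GRing.Theory Num.Theory.

(** * The lexicographic order *)

Section LexOrder.
Variable m : nat.
Implicit Types u v w : 'X_{1..m}.

Lemma lex_ltP u v :
  reflect (exists2 i : 'I_m, u i < v i & forall j : 'I_m, i < j -> u j = v j)
          (lex_lt u v).
Proof.
apply: (iffP existsP) => [[i /andP[uv /forallP eq_uv]]|[i uv eq_uv]].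
  by exists i => // j ij; apply/eqP; have /implyP := eq_uv j; apply.
by exists i; rewrite uv; apply/forallP => j; apply/implyP => /eq_uv ->.
Qed.

Lemma lex_ltxx u : lex_lt u u = false.
Proof. by apply/lex_ltP => -[i]; rewrite ltnn. Qed.

Lemma lex_lt_trans : transitive (@lex_lt m).
Proof.
move=> v u w /lex_ltP[i uv Ei] /lex_ltP[j vw Ej]; apply/lex_ltP.
have [ij|ji|eq_ij] := ltngtP i j.
- by exists j => [|k jk]; [rewrite Ei | rewrite Ei ?Ej // (ltn_trans ij)].
- by exists i => [|k ik]; [rewrite -Ej | rewrite Ei ?Ej // (ltn_trans ji)].
- have {}eq_ij := val_inj eq_ij; rewrite -eq_ij in vw Ej.
  by exists i => [|k ik]; [exact: ltn_trans vw | rewrite Ei ?Ej].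
Qed.

Lemma lex_lt_total u v : u != v -> lex_lt u v || lex_lt v u.
Proof.
move=> neq_uv; have [i0 Di0] : exists i0 : 'I_m, u i0 != v i0.
  apply/existsP; rewrite -negb_forall; apply: contra neq_uv => /forallP E.
  by apply/eqP/mnmP => i; apply/eqP.
have [i Di max_i] := @arg_maxnP _ i0 (fun i => u i != v i) val Di0.
have Ei (j : 'I_m) : i < j -> u j = v j.
  by move=> ij; apply/eqP; apply: contraLR ij => /max_i; rewrite -leqNgt.
have [uv|vu] : u i < v i \/ v i < u i by lia.
- by apply/orP; left; apply/lex_ltP; exists i.
- by apply/orP; right; apply/lex_ltP; exists i => // j /Ei.
Qed.

Lemma lex_ltD2r w u v : lex_lt (u + w)%MM (v + w)%MM = lex_lt u v.
Proof.
apply/lex_ltP/lex_ltP => -[i uv Ei]; exists i => [|j /Ei];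
  by move: uv; rewrite !mnmDE; lia.
Qed.

End LexOrder.

(** * Vertex degrees and alternating walks *)

Section EdgeDegrees.
Variables (n m : nat) (e : m.-tuple {set 'I_n}).
Implicit Types (u v : 'X_{1..m}) (x y : 'I_n) (k : 'I_m).

(* [edeg u] is the exponent of the image of the monomial y^u in K[x_1..x_n]. *)
Definition edeg u x : nat := \sum_k u k * (x \in tnth e k).

Lemma edeg0 x : edeg 0%MM x = 0.
Proof. by rewrite /edeg big1 // => k _; rewrite mnm0E. Qed.

Lemma edegU k x : edeg U_(k)%MM x = (x \in tnth e k).
Proof.
rewrite /edeg (bigD1 k) //= mnm1E eqxx mul1n big1 ?addn0 // => j.
by rewrite mnm1E eq_sym => /negbTE->.
Qed.

Lemma edegD u v x : edeg (u + v)%MM x = edeg u x + edeg v x.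
Proof. by rewrite -big_split; apply: eq_bigr => k _; rewrite mnmDE mulnDl. Qed.

Lemma edegB u v x : (v <= u)%MM -> edeg (u - v)%MM x = edeg u x - edeg v x.
Proof. by move=> /submK le_vu; rewrite -{2}le_vu edegD addnK. Qed.

Lemma edeg_le u v x : (u <= v)%MM -> edeg u x <= edeg v x.
Proof. by move=> /submK <-; rewrite edegD leq_addl. Qed.

Lemma edeg_sum I (r : seq I) (P : pred I) (F : I -> 'X_{1..m}) x :
  edeg (\sum_(i <- r | P i) F i)%MM x = \sum_(i <- r | P i) edeg (F i) x.
Proof. exact: (big_morph _ (fun u v => edegD u v x) (edeg0 x)). Qed.

Lemma edeg_gt0 u x : 0 < edeg u x -> exists2 k, 0 < u k & x \in tnth e k.
Proof.
rewrite lt0n sum_nat_eq0 negb_forall => /existsP[k].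
by rewrite muln_eq0 negb_or -lt0n eqb0 negbK => /andP[uk xk]; exists k.
Qed.

Hypothesis graph_edges :
  forall k, exists x y, x != y /\ tnth e k = [set x; y].

Lemma edge_end k x : x \in tnth e k -> exists2 y, x != y & tnth e k = [set x; y].
Proof.
have [a [b [ab ->]]] := graph_edges k; rewrite !inE => /orP[]/eqP->.
  by exists b.
by exists a; rewrite 1?eq_sym // setUC.
Qed.

Lemma edge_neq k x y : tnth e k = [set x; y] -> x != y.
Proof.
have [b [c [bc ->]]] := graph_edges k; apply: contra_eq_neq => ->.
by apply/eqP => E; have := cards2 b c; rewrite bc E setUid cards1.
Qed.

Lemma in_edge (x y z : 'I_n) : x != y -> z \in [set x; y] = (x == z) + (y == z) :> nat.
Proof.
rewrite !inE (eq_sym x z) (eq_sym y z).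
by case: (eqVneq z x) => [->|_] //=; case: eqVneq.
Qed.

(** Handshake count: every edge has two ends. Hence binomials of the toric ideal are homogeneous. *)
Lemma sum_edeg u : \sum_x edeg u x = (mdeg u).*2.
Proof.
rewrite /edeg exchange_big mdegE -muln2 big_distrl /=; apply: eq_bigr => k _.
rewrite -big_distrr /=; congr (_ * _).
have [a [b [ab ->]]] := graph_edges k.
have <- : #|[set a; b]| = 2 by rewrite cards2 ab.
by rewrite -sum1_card [RHS]big_mkcond; apply: eq_bigr => x _; case: (x \in _).
Qed.

Lemma eq_edeg_mdeg u v : edeg u =1 edeg v -> mdeg u = mdeg v.
Proof.
by move=> E; apply: double_inj; rewrite -!sum_edeg; apply: eq_bigr => x _.
Qed.

Lemma eq_edeg_le u v : (u <= v)%MM -> edeg u =1 edeg v -> u = v.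
Proof.
move=> le_uv /eq_edeg_mdeg E; apply/esym; rewrite -(submK le_uv) in E *.
move: E; rewrite mdegD => E.
have /eqP : mdeg (v - u)%MM = 0 by lia.
by rewrite mdeg_eq0 => /eqP->; rewrite add0m.
Qed.

(* Such a trail cannot get stuck: the degree condition provides an unused edge
   of v at x, then one of u at its other end, unless that end is a. *)
Lemma alternating_trail (a : 'I_n) N u v x :
  mdeg u + mdeg v <= N ->
  (forall y, edeg v y = edeg u y + (a == y) + (x == y)) ->
  exists L (w : nat -> 'I_n) (f : nat -> 'I_m),
    [/\ w 0 = x, w L = a, odd L,
        forall i, i < L -> tnth e (f i) = [set w i; w i.+1]
      & (\sum_(0 <= i < L | ~~ odd i) U_(f i) <= v)%MM
        /\ (\sum_(0 <= i < L | odd i) U_(f i) <= u)%MM].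
Proof.
elim: N u v x => [|N IHN] u v x leN Dv.
  have : 0 < edeg v x by rewrite Dv eqxx; lia.
  case/edeg_gt0 => k; have /eqP -> : v == 0%MM by rewrite -mdeg_eq0; lia.
  by rewrite mnm0E.
have : 0 < edeg v x by rewrite Dv eqxx; lia.
case/edeg_gt0 => k vk /edge_end[y xy Ek].
have le_kv : (U_(k) <= v)%MM by rewrite lep1mP -lt0n.
have Dv1 z : edeg (v - U_(k))%MM z + (y == z) = edeg u z + (a == z).
  have := edeg_le z le_kv; rewrite edegB // edegU Ek in_edge // Dv; lia.
have [ya|y_a] := eqVneq y a.
  exists 1, (fun i => if i is 0 then x else a), (fun=> k); split=> //.
  - by case=> //= _; rewrite -ya.
  - by split; rewrite big_mkcond big_nat1 //=; apply/mnm_lepP => j; rewrite mnm0E.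
have : 0 < edeg u y.
  by have := Dv1 y; rewrite eqxx eq_sym (negbTE y_a); lia.
case/edeg_gt0 => k' uk' /edge_end[z yz Ek'].
have le_ku : (U_(k') <= u)%MM by rewrite lep1mP -lt0n.
have Du1 t : edeg (u - U_(k'))%MM t + (y == t) + (z == t) = edeg u t.
  by have := edeg_le t le_ku; rewrite edegB // edegU Ek' in_edge //; lia.
(* Removing both edges moves the excess of [v] over [u] from [x] to [z]. *)
have [] := IHN (u - U_(k'))%MM (v - U_(k))%MM z.
- move/submK: le_ku => <- in leN; move/submK: le_kv => <- in leN.
  by move: leN; rewrite !mdegD !mdeg1; lia.
- by move=> t; have := Dv1 t; have := Du1 t; lia.
move=> L [w [f [w0 wL oddL wf [lev leu]]]].
exists L.+2, (fun i => if i is i1.+1 then if i1 is i2.+1 then w i2 else y else x).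
exists (fun i => if i is i1.+1 then if i1 is i2.+1 then f i2 else k' else k).
split=> //=; first by rewrite negbK.
- by case=> [|[|i]] //=; rewrite ?w0 // => /wf.
have shift (P : pred nat) (F : nat -> 'X_{1..m}) :
    (\sum_(0 <= i < L.+2 | P i) F i = (if P 0%N then F 0%N else 0) +
      ((if P 1%N then F 1%N else 0) + \sum_(0 <= i < L | P i.+2) F i.+2))%MM.
  by rewrite big_mkcond !big_nat_recl // -big_mkcond.
rewrite !shift /= !add0m; split.
  under eq_bigl do rewrite negbK.
  rewrite -(submK le_kv) addmC; apply/mnm_lepP => j; rewrite !mnmDE leq_add2r.
  exact: (mnm_lepP lev).
under eq_bigl do rewrite negbK.
rewrite -(submK le_ku) addmC; apply/mnm_lepP => j; rewrite !mnmDE leq_add2r.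
exact: (mnm_lepP leu).
Qed.

Section Walk.
Variables (Q : nat) (w : nat -> 'I_n) (f : nat -> 'I_m).
Hypothesis walk_f : forall i, i < Q -> tnth e (f i) = [set w i; w i.+1].

(* The edge f i joins w i to w i.+1; positions are numbered from 0, so that
   [walk_part false] collects the edges in odd position of the paper. *)
Definition walk_part (c : bool) (A : seq nat) : 'X_{1..m} :=
  (\sum_(i <- A | odd i == c) U_(f i))%MM.

(** Vertex degrees with alternating signs. They vanish everywhere exactly when the even and the odd
    positions of [A] give monomials with the same image. *)
Definition walk_deg (A : seq nat) x : int :=
  (\sum_(i <- A) (-1) ^+ odd i * Posz (edeg U_(f i)%MM x))%R.

Lemma walk_deg_cat A B x : walk_deg (A ++ B) x = (walk_deg A x + walk_deg B x)%R.
Proof. by rewrite /walk_deg big_cat. Qed.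

Lemma walk_deg_cons i A x :
  walk_deg (i :: A) x = ((-1) ^+ odd i * Posz (edeg U_(f i)%MM x) + walk_deg A x)%R.
Proof. by rewrite /walk_deg big_cons. Qed.

Lemma walk_partE A x :
  (Posz (edeg (walk_part false A) x) - Posz (edeg (walk_part true A) x) = walk_deg A x)%R.
Proof.
rewrite /walk_part !edeg_sum; elim: A => [|i A IH]; first by rewrite /walk_deg !big_nil.
by rewrite walk_deg_cons !big_cons -IH; case: (odd i) => /=; rewrite ?expr0 ?expr1; lia.
Qed.

Lemma walk_step i : i < Q -> w i != w i.+1.
Proof. by move/walk_f/edge_neq. Qed.

Lemma edegU_walk i x : i < Q -> edeg U_(f i)%MM x = (w i == x) + (w i.+1 == x).
Proof. by move=> iQ; rewrite edegU walk_f // in_edge ?walk_step. Qed.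

(** An inner vertex is shared by two consecutive edges of opposite sign, so the sum telescopes to
    its two ends. *)
Lemma walk_deg_iota i j x : i <= j -> j <= Q ->
  walk_deg (index_iota i j) x =
  ((-1) ^+ odd i * Posz (w i == x) - (-1) ^+ odd j * Posz (w j == x))%R.
Proof.
move=> ij jQ; rewrite /walk_deg.
pose F (k : nat) : int := (- ((-1) ^+ odd k * Posz (w k == x)))%R.
rewrite (eq_big_nat _ _ (F2 := fun k : nat => (F k.+1 - F k)%R)) => [|k /andP[_ kj]].
  by rewrite telescope_sumr // /F; lia.
rewrite edegU_walk ?(leq_trans kj) // /F /=.
by case: (odd k); rewrite /= ?expr0 ?expr1; lia.
Qed.

End Walk.

End EdgeDegrees.

(** * Binomials whose leading monomial is a minimal generator *)

Section MinimalBinomials.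
Variables (n m : nat) (e : m.-tuple {set 'I_n}).
Hypothesis graph_edges :
  forall k, exists x y : 'I_n, x != y /\ tnth e k = [set x; y].
Hypothesis linear_quotients : forall k l : 'I_m,
  [disjoint tnth e k & tnth e l] ->
  exists (j : 'I_m) (x y : 'I_n),
    [/\ j < maxn k l, x \in tnth e k, y \in tnth e l & tnth e j = [set x; y]].

(** Here y^u is a minimal generator of the initial ideal and y^v any smaller monomial with the same
    image. This covers both the elements of a reduced Groebner basis and the irreducible case in the
    induction of [ideal_gen_binomial]. *)
Definition minimal_binomial (u v : 'X_{1..m}) : Prop :=
  [/\ edeg e u =1 edeg e v, lex_lt v u
    & forall u1 v1, (u1 <= u)%MM -> edeg e u1 =1 edeg e v1 -> lex_lt v1 u1 -> u1 = u].

Section Fixed.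
Variables u v : 'X_{1..m}.
Hypothesis uv_min : minimal_binomial u v.

Let uvE x : edeg e u x = edeg e v x. Proof. by case: uv_min. Qed.

(** Cancelling a common variable would leave a leading monomial properly dividing y^u. *)
Lemma minimal_binomial_coprime k : u k = 0 \/ v k = 0.
Proof.
case: uv_min => _ lt_vu minu.
have [|uk] := posnP (u k); first by left.
have [|vk] := posnP (v k); first by right.
have ku : (U_(k) <= u)%MM by rewrite lep1mP -lt0n.
have kv : (U_(k) <= v)%MM by rewrite lep1mP -lt0n.
have /mnmP/(_ k) : (u - U_(k))%MM = u.
  apply: (minu _ (v - U_(k))%MM); first exact: lem_subr.
    by move=> x; rewrite !edegB // uvE.
  by rewrite -(lex_ltD2r U_(k)) !submK.
by rewrite mnmBE mnm1E eqxx; lia.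
Qed.

(** By coprimality, the largest index where [u] and [v] differ is the largest variable occurring at
    all. *)
Lemma minimal_binomial_top :
  exists E : 'I_m, [/\ 0 < u E, v E = 0 & forall j : 'I_m, E < j -> u j = 0 /\ v j = 0].
Proof.
case: uv_min => _ /lex_ltP[E vuE Ej] _.
exists E; split; first by lia.
  by case: (minimal_binomial_coprime E) => // uE; move: vuE; rewrite uE.
move=> j /Ej vuj; by case: (minimal_binomial_coprime j) => zj; rewrite -?vuj ?zj // vuj.
Qed.

(** Either the pair [u1], [v1] or its complement in [u], [v] contains [E]. The one that does has its
    leading monomial inside [u], hence equal to [u]. *)
Lemma minimal_binomial_primitive u1 v1 :
  (u1 <= u)%MM -> (v1 <= v)%MM -> edeg e u1 =1 edeg e v1 -> u1 = 0%MM \/ u1 = u.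
Proof.
have [E [uE vE Ej]] := minimal_binomial_top; case: uv_min => _ _ minu.
have key u2 v2 : (u2 <= u)%MM -> (v2 <= v)%MM -> edeg e u2 =1 edeg e v2 ->
    0 < u2 E -> u2 = u.
  move=> le_u le_v E2 u2E; apply: (minu _ v2) => //; apply/lex_ltP; exists E.
    by apply: leq_ltn_trans u2E; rewrite -vE; apply/(mnm_lepP le_v).
  move=> j /Ej[uj vj].
  by have := mnm_lepP le_u j; have := mnm_lepP le_v j; lia.
move=> le_u le_v E1; have [u1E|] := posnP (u1 E); last by right; exact: key E1 _.
left; apply/mnmP => j; rewrite mnm0E.
have /mnmP/(_ j) : (u - u1)%MM = u.
  apply: (key _ (v - v1)%MM); rewrite ?lem_subr ?mnmBE ?u1E ?subn0 //.
  by move=> x; rewrite !edegB // uvE E1.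
by have := mnm_lepP le_u j; rewrite mnmBE; lia.
Qed.

(** Once [E] is removed from [u], an alternating trail joins its two ends, and [E] closes it up. The
    binomial of this closed walk involves [E], so by primitivity it is everything. *)
Lemma minimal_binomial_walk (E : 'I_m) : 0 < u E -> v E = 0 ->
  (forall j : 'I_m, E < j -> u j = 0 /\ v j = 0) ->
  exists Q (w : nat -> 'I_n) (f : nat -> 'I_m),
  [/\ 0 < Q /\ ~~ odd Q, w Q = w 0 /\ f 0 = E,
      forall i, i < Q -> tnth e (f i) = [set w i; w i.+1],
      u = walk_part f false (index_iota 0 Q)
    & v = walk_part f true (index_iota 0 Q)].
Proof.
move=> uE vE Ej; have [a [a' [aa' eE]]] := graph_edges E.
have le_Eu : (U_(E) <= u)%MM by rewrite lep1mP -lt0n.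
have Du (y : 'I_n) : edeg e v y = edeg e (u - U_(E))%MM y + (a == y) + (a' == y).
  have := edeg_le e y le_Eu.
  by rewrite edegB // -uvE edegU eE in_edge //; lia.
have [L [w [f [w0 wL oddL wf [le_v le_u]]]]] :=
  alternating_trail graph_edges (leqnn _) Du.
pose w' i := if i is i1.+1 then w i1 else a.
pose f' i := if i is i1.+1 then f i1 else E.
have w'f i : i < L.+1 -> tnth e (f' i) = [set w' i; w' i.+1].
  by case: i => [|i] /=; [rewrite w0 | move/wf].
have shift (P : pred nat) (F : nat -> 'X_{1..m}) :
    (\sum_(0 <= i < L.+1 | P i) F i = (if P 0%N then F 0%N else 0) +
      \sum_(0 <= i < L | P i.+1) F i.+1)%MM.
  by rewrite big_mkcond big_nat_recl // -big_mkcond.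
pose u1 := walk_part f' false (index_iota 0 L.+1).
pose v1 := walk_part f' true (index_iota 0 L.+1).
have le_u1 : (u1 <= u)%MM.
  rewrite /u1 /walk_part shift /=.
  under eq_bigl => i do rewrite eqbF_neg negbK.
  rewrite -[u in (_ <= u)%MM](submK le_Eu) addmC.
  by apply/mnm_lepP => j; rewrite !mnmDE leq_add2r; exact: (mnm_lepP le_u).
have le_v1 : (v1 <= v)%MM.
  rewrite /v1 /walk_part shift /= add0m.
  by under eq_bigl => i do rewrite eqb_id.
have E1 : edeg e u1 =1 edeg e v1.
  move=> x; have := walk_deg_iota graph_edges w'f x (leq0n _) (leqnn _).
  by rewrite -walk_partE /= oddL wL subrr => /eqP; rewrite subr_eq0 eqz_nat => /eqP.
have u1u : u1 = u.
  case: (minimal_binomial_primitive le_u1 le_v1 E1) => // /mnmP/(_ E).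
  by rewrite /u1 /walk_part shift /= mnmDE mnm1E eqxx mnm0E.
have v1v : v1 = v.
  by apply: (eq_edeg_le graph_edges le_v1) => x; rewrite -E1 u1u uvE.
by exists L.+1, w', f'; rewrite /= oddL wL.
Qed.

(** * Chords and repeated vertices of the closed walk *)

Section Positions.
Variables (E : 'I_m) (Q : nat) (w : nat -> 'I_n) (f : nat -> 'I_m).
Hypotheses (uE : 0 < u E) (vE : v E = 0).
Hypothesis E_top : forall j : 'I_m, E < j -> u j = 0 /\ v j = 0.
Hypotheses (Q_gt0 : 0 < Q) (even_Q : ~~ odd Q) (closed : w Q = w 0) (f0 : f 0 = E).
Hypothesis walk_f : forall i, i < Q -> tnth e (f i) = [set w i; w i.+1].
Hypothesis u_walk : u = walk_part f false (index_iota 0 Q).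
Hypothesis v_walk : v = walk_part f true (index_iota 0 Q).

Local Notation wdeg := (walk_deg e f).

Lemma walk_part_le c A : uniq A -> {in A, forall i, i < Q} ->
  (walk_part f c A <= walk_part f c (index_iota 0 Q))%MM.
Proof.
move=> uniqA A_Q; apply: (uniq_sub_le_big (@lepm_refl m) (@lem_addr m)) => //.
  exact: iota_uniq.
by move=> i /A_Q; rewrite mem_index_iota.
Qed.

(* Moving c to the side of the odd positions of A gives a binomial of I_G whose
   leading monomial, carried by the even positions of A, divides y^u. *)
Lemma chord A (c : 'X_{1..m}) : uniq A -> {in A, forall i, i < Q} -> 0 \in A ->
  (forall j : 'I_m, E <= j -> c j = 0) ->
  (forall x, wdeg A x = Posz (edeg e c x)) ->
  forall t, t < Q -> ~~ odd t -> t \in A.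
Proof.
move=> uniqA A_Q A0 cE degA t tQ even_t; apply/negPn/negP => tA.
have le_red := walk_part_le false uniqA A_Q.
have le_blue := walk_part_le true uniqA A_Q.
rewrite -u_walk in le_red; rewrite -v_walk in le_blue.
case: uv_min => _ _ minu.
have redu : walk_part f false A = u.
  apply: (minu _ (walk_part f true A + c)%MM) => //.
    move=> x; apply/eqP; rewrite -eqz_nat edegD PoszD -degA -walk_partE; lia.
  apply/lex_ltP; exists E.
    rewrite mnmDE cE // addn0; have := mnm_lepP le_blue E; rewrite vE leqn0 => /eqP->.
    rewrite /walk_part (big_rem 0) //= mnmDE f0 mnm1E eqxx; lia.
  move=> j Ej; have [uj vj] := E_top Ej; rewrite mnmDE cE ?(ltnW Ej) //.
  by have := mnm_lepP le_blue j; have := mnm_lepP le_red j; lia.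
(* With the position [t] added, [A] still lies on the walk, although [A] alone already exhausts
   [u]. *)
have : (walk_part f false (t :: A) <= u)%MM.
  rewrite u_walk; apply: walk_part_le; first by rewrite /= tA.
  by move=> i; rewrite inE => /orP[/eqP->|/A_Q].
move/mnm_lepP/(_ (f t)).
rewrite /walk_part big_cons (negbTE even_t) /= mnmDE mnm1E eqxx.
by rewrite -/(walk_part f false A) redu; lia.
Qed.

Lemma balanced A : uniq A -> {in A, forall i, i < Q} -> 0 \in A ->
  (forall x, wdeg A x = 0) -> forall t, t < Q -> ~~ odd t -> t \in A.
Proof.
move=> uniqA A_Q A0 degA; apply: (@chord A 0%MM) => //.
  by move=> j _; rewrite mnm0E.
by move=> x; rewrite degA edeg0.
Qed.

(** Two visits of equal parity cut the walk into two even closed walks. The one through position 0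
    is balanced, yet it misses an even position. *)
Lemma no_even_repeat i j : i < j -> j < Q -> odd i = odd j -> w i = w j -> False.
Proof.
move=> ij jQ odd_ij wij.
pose A := index_iota 0 i ++ index_iota j Q.
have uniqA : uniq A.
  rewrite cat_uniq !iota_uniq andbT; apply/hasPn => k; rewrite /= !mem_index_iota; lia.
have [i0|i_gt0] := posnP i.
  have degB x : wdeg (index_iota 0 j) x = 0.
    by rewrite (walk_deg_iota graph_edges walk_f) ?(ltnW jQ) // -odd_ij -wij i0 subrr.
  have := balanced (iota_uniq _ _) _ _ degB jQ; rewrite !mem_index_iota -odd_ij i0 ltnn.
  move=> H; suff: false by []. apply: H => //; last by lia.
  by move=> k; rewrite mem_index_iota; lia.
have degA x : wdeg A x = 0.
  rewrite walk_deg_cat !(walk_deg_iota graph_edges walk_f) ?(ltnW jQ) //; last by lia.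
  by rewrite odd_ij wij (negbTE even_Q) closed /=; case: (odd j); rewrite ?expr0 ?expr1; lia.
have A_Q : {in A, forall k, k < Q}.
  by move=> k; rewrite mem_cat !mem_index_iota; lia.
have A0 : 0 \in A by rewrite mem_cat !mem_index_iota; lia.
have := balanced uniqA A_Q A0 degA (t := if odd i then i.+1 else i).
rewrite mem_cat !mem_index_iota; case: ifP => [oi|oi] /(_ _ _); lia.
Qed.

(* The walk runs through the positions below x0, then through [a, b) and
   [c, d), possibly backwards; [h] is the chord closing it up, if any. *)
Lemma pieces (h : 'X_{1..m}) x0 a b c d :
  [&& 0 < x0, x0 <= a, a <= b, b <= c, c <= d & d <= Q] ->
  (forall j : 'I_m, E <= j -> h j = 0) ->
  (forall x, Posz (w 0 == x) - (-1) ^+ odd x0 * Posz (w x0 == x)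
     + ((-1) ^+ odd a * Posz (w a == x) - (-1) ^+ odd b * Posz (w b == x))
     + ((-1) ^+ odd c * Posz (w c == x) - (-1) ^+ odd d * Posz (w d == x))
     = Posz (edeg e h x))%R ->
  forall t, t < Q -> ~~ odd t -> [|| t < x0, a <= t < b | c <= t < d].
Proof.
move=> le hE deg t tQ even_t.
pose A := index_iota 0 x0 ++ index_iota a b ++ index_iota c d.
have : t \in A.
  apply: (chord (c := h)) => //.
  - rewrite !cat_uniq !iota_uniq andbT /=; apply/andP; split; apply/hasPn => k;
      by rewrite /= ?mem_cat !mem_index_iota; lia.
  - by move=> k; rewrite !mem_cat !mem_index_iota; lia.
  - by rewrite !mem_cat !mem_index_iota; lia.
  move=> x; rewrite -deg !walk_deg_cat !(walk_deg_iota graph_edges walk_f);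
    by [rewrite /= expr0; lia | lia].
by rewrite !mem_cat !mem_index_iota.
Qed.

Lemma pieces_absurd (h : 'X_{1..m}) x0 a b c d t :
  (forall j : 'I_m, E <= j -> h j = 0) ->
  [&& 0 < x0, x0 <= a, a <= b, b <= c, c <= d & d <= Q] ->
  [&& t < Q, ~~ odd t, x0 <= t, ~~ (a <= t < b) & ~~ (c <= t < d)] ->
  (forall x, Posz (w 0 == x) - (-1) ^+ odd x0 * Posz (w x0 == x)
     + ((-1) ^+ odd a * Posz (w a == x) - (-1) ^+ odd b * Posz (w b == x))
     + ((-1) ^+ odd c * Posz (w c == x) - (-1) ^+ odd d * Posz (w d == x))
     = Posz (edeg e h x))%R -> False.
Proof.
move=> hE le /and5P[tQ even_t t1 t2 t3] deg.
by have := pieces le hE deg tQ even_t; rewrite (negbTE t2) (negbTE t3) ltnNge t1.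
Qed.

Lemma walk_edge_le k : k < Q -> f k <= E.
Proof.
move=> kQ; rewrite leqNgt; apply/negP => /E_top[uk vk].
have le_k c : odd k = c -> (walk_part f c [:: k] <= walk_part f c (index_iota 0 Q))%MM.
  by move=> _; apply: walk_part_le => // i; rewrite inE => /eqP->.
case odd_k: (odd k); have /mnm_lepP/(_ (f k)) := le_k _ odd_k;
  rewrite -?u_walk -?v_walk ?uk ?vk /walk_part big_cons big_nil odd_k /=;
  by rewrite addm0 mnm1E eqxx.
Qed.

Lemma chord_deg (h : 'I_m) (y z : 'I_n) : tnth e h = [set y; z] ->
  forall x, edeg e U_(h)%MM x = (y == x) + (z == x).
Proof. by move=> Eh x; rewrite edegU Eh in_edge ?(edge_neq graph_edges Eh). Qed.

Lemma chord_small (h : 'I_m) : h < E -> forall j : 'I_m, E <= j -> U_(h)%MM j = 0.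
Proof. by move=> hE j Ej; rewrite mnm1E -val_eqE /= ltn_eqF // (leq_trans hE). Qed.

Let signs := (expr0, expr1, closed, negbTE even_Q).

(** From [w 0] the vertex [w t] is reached directly, in [t] steps, or via [w i = w j] and backwards,
    in [i + (j - t)] steps. Exactly one of these lengths is odd, and that trail closed by [h]
    contradicts [pieces]. *)
Lemma no_chord0 i j t (h : 'I_m) : 1 < i -> i < t -> t < j -> j < Q -> w i = w j ->
  odd j = ~~ odd i -> h < E -> tnth e h = [set w 0; w t] -> False.
Proof.
move=> i_gt1 it tj jQ wij odd_j hE Eh.
have hdeg := chord_deg Eh; have hs := chord_small hE.
case odd_t: (odd t).
  apply: (@pieces_absurd _ t t t t t t.+1 hs) => [||x]; [lia | lia |].
  by rewrite hdeg odd_t ?signs; lia.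
apply: (@pieces_absurd _ i t j j j (if odd i then j else i) hs) => [||x].
- by lia.
- by case: ifP => oi; lia.
by rewrite hdeg odd_t odd_j wij; case: (odd i); rewrite /= ?signs; lia.
Qed.

(** The same alternative in the other direction: from [w 1] over [E] to [w 0 = w Q], then backwards
    to [w t], or backwards to [w j = w i] and forwards to [w t]. *)
Lemma no_chord1 i j t (h : 'I_m) : 1 < i -> i < t -> t < j -> j < Q -> w i = w j ->
  odd j = ~~ odd i -> h < E -> tnth e h = [set w 1; w t] -> False.
Proof.
move=> i_gt1 it tj jQ wij odd_j hE Eh.
have hdeg := chord_deg Eh; have hs := chord_small hE.
case odd_t: (odd t).
  apply: (@pieces_absurd _ 1 i t j Q (if odd i then 2 else t.+1) hs) => [||x].
  - by lia.
  - by case: ifP => oi; lia.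
  by rewrite hdeg odd_t odd_j wij; case: (odd i); rewrite /= ?signs; lia.
apply: (@pieces_absurd _ 1 t Q Q Q 2 hs) => [||x].
- by lia.
- by lia.
by rewrite hdeg odd_t; rewrite /= ?signs; lia.
Qed.

(** Degenerate case of [no_chord0]: the trail closes up without a chord. *)
Lemma no_cross0 i j t : 1 < i -> i < t -> t < j -> j < Q -> w i = w j ->
  odd j = ~~ odd i -> w t = w 0 -> False.
Proof.
move=> i_gt1 it tj jQ wij odd_j wt.
case odd_t: (odd t); last by apply: (@no_even_repeat 0 t) => //; lia.
apply: (@pieces_absurd 0%MM i t j j j t.-1) => [k _|||x].
- by rewrite mnm0E.
- by lia.
- by lia.
by rewrite edeg0 odd_t odd_j wij wt; case: (odd i); rewrite /= ?signs; lia.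
Qed.

(** Degenerate case of [no_chord1]. *)
Lemma no_cross1 i j t : 1 < i -> i < t -> t < j -> j < Q -> w i = w j ->
  odd j = ~~ odd i -> w t = w 1 -> False.
Proof.
move=> i_gt1 it tj jQ wij odd_j wt.
case odd_t: (odd t); first by apply: (@no_even_repeat 1 t) => //; lia.
apply: (@pieces_absurd 0%MM 1 i t j Q t) => [k _|||x].
- by rewrite mnm0E.
- by lia.
- by lia.
by rewrite edeg0 odd_t odd_j wij wt; case: (odd i); rewrite /= ?signs; lia.
Qed.

Lemma eE : tnth e E = [set w 0; w 1]. Proof. by rewrite -f0 walk_f. Qed.

(** The part from [i] to [j] is an odd closed walk, and the edge at position [i.+1] lies inside it.
    That edge is disjoint from [E], since the walk does not cross the ends of [E] there, so linear
    quotients provide a chord smaller than [E] between the two, which is excluded. *)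
Lemma no_inner_repeat i j : 1 < i -> i < j -> j < Q -> w i = w j -> False.
Proof.
move=> i_gt1 ij jQ wij.
have odd_j : odd j = ~~ odd i.
  case: (odd i =P odd j) => [/no_even_repeat Eij|]; first by case: (Eij).
  by case: (odd i); case: (odd j).
have j_i1 : j != i.+1.
  by apply: contra_eq_neq wij => ->; apply: (walk_step graph_edges walk_f); lia.
have wf : tnth e (f i.+1) = [set w i.+1; w i.+2] by apply: walk_f; lia.
have [p [x [y [p_max xE yf Ep]]]] : exists (p : 'I_m) (x y : 'I_n),
    [/\ p < maxn E (f i.+1), x \in tnth e E, y \in tnth e (f i.+1)
      & tnth e p = [set x; y]].
  apply: linear_quotients; rewrite disjoint_subset; apply/subsetP => z.
  rewrite eE wf !inE => /orP[]/eqP->; apply/negP => /orP[]/eqP Ez.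
  - by apply: (@no_cross0 i j i.+1) => //; lia.
  - by apply: (@no_cross0 i j i.+2) => //; lia.
  - by apply: (@no_cross1 i j i.+1) => //; lia.
  - by apply: (@no_cross1 i j i.+2) => //; lia.
have pE : p < E.
  by apply: leq_trans p_max _; rewrite geq_max leqnn walk_edge_le //; lia.
have i1Q : i.+1 < Q by lia.
move: xE yf Ep; rewrite eE wf !inE => /orP[]/eqP-> /orP[]/eqP-> Ep.
- by apply: (@no_chord0 i j i.+1 p) => //; lia.
- by apply: (@no_chord0 i j i.+2 p) => //; lia.
- by apply: (@no_chord1 i j i.+1 p) => //; lia.
- by apply: (@no_chord1 i j i.+2 p) => //; lia.
Qed.

(** By parity, [s] is odd and [t] even. If [s < t], then [E] and the part from [s] to [t] form an
    even closed walk. Otherwise odd closed walks hang at both ends of [E], and linear quotients join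
    an edge of one to an edge of the other. *)
Lemma one_end_repeat s t : 0 < s < Q -> 1 < t < Q -> w s = w 0 -> w t = w 1 -> False.
Proof.
move=> sQ tQ ws wt.
case odd_s: (odd s); last by apply: (@no_even_repeat 0 s) => //; lia.
case odd_t: (odd t); first by apply: (@no_even_repeat 1 t) => //; lia.
have [st|ts|] := ltngtP s t; last by lia.
  apply: (@pieces_absurd 0%MM 1 s t t t t) => [k _|||x].
  - by rewrite mnm0E.
  - by lia.
  - by lia.
  by rewrite edeg0 odd_s odd_t ws wt /= ?signs; lia.
have t2 : t != 2.
  apply: contra_eq_neq wt => ->; rewrite eq_sym.
  by apply: (walk_step graph_edges walk_f); lia.
have sQ1 : s.+1 != Q.
  apply: contra_eq_neq ws => sQ1; rewrite -closed -sQ1.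
  by apply: (walk_step graph_edges walk_f); lia.
have Q_s : s.+2 < Q by lia.
have w2 : tnth e (f 2) = [set w 2; w 3] by apply: walk_f; lia.
have ws1 : tnth e (f s.+1) = [set w s.+1; w s.+2] by apply: walk_f; lia.
have [h [x [y [h_max xE yf Eh]]]] : exists (h : 'I_m) (x y : 'I_n),
    [/\ h < maxn (f 2) (f s.+1), x \in tnth e (f 2), y \in tnth e (f s.+1)
      & tnth e h = [set x; y]].
  apply: linear_quotients; rewrite disjoint_subset; apply/subsetP => z.
  rewrite w2 ws1 !inE => /orP[]/eqP->; apply/negP => /orP[]/eqP Ez;
    by apply: no_inner_repeat Ez; lia.
have hE : h < E.
  by apply: leq_trans h_max _; rewrite geq_max !walk_edge_le //; lia.
have [p p23 xp] : exists2 p, 1 < p < 4 & x = w p.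
  by move: xE; rewrite w2 !inE => /orP[]/eqP->; [exists 2 | exists 3].
have [r r12 yr] : exists2 r, s < r < s.+3 & y = w r.
  by move: yf; rewrite ws1 !inE => /orP[]/eqP->; [exists s.+1 => // | exists s.+2 => //]; lia.
rewrite xp yr in Eh; have hdeg := chord_deg Eh; have hs := chord_small hE.
(* Each odd closed walk is traversed in the direction that reaches the end of [h] after an even
   number of steps; with [E] and [h] this is an even closed walk, and it misses position [t]. *)
apply: (@pieces_absurd _ 1 (if odd p then 1 else p) (if odd p then p else t)
          (if odd r then s else r) (if odd r then r else Q) t hs) => [||z].
- by case: (odd p); case: (odd r); lia.
- by case: ifP => op; case: ifP => odr; lia.
rewrite hdeg; case: ifP => op; case: ifP => odr;
  by rewrite /= ?op ?odr ?odd_s ?odd_t ?ws ?wt /= ?signs; lia.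
Qed.

(** The edges at even positions pair off the positions 0 to Q - 1, so each visit is counted once. *)
Lemma edeg_walk x : edeg e u x = #|[set k : 'I_Q | w k == x]|.
Proof.
have -> : #|[set k : 'I_Q | w k == x]| = \sum_(0 <= k < Q) (w k == x).
  rewrite -sum1dep_card big_mkcond big_mkord; apply: eq_bigr => k _.
  by case: (w k == x).
rewrite u_walk /walk_part edeg_sum.
have -> : \sum_(i <- index_iota 0 Q | odd i == false) edeg e U_(f i)%MM x
    = \sum_(0 <= i < Q | ~~ odd i) ((w i == x) + (w i.+1 == x)).
  rewrite big_nat_cond [RHS]big_nat_cond; apply: eq_big => k; first by rewrite eqbF_neg.
  by case/andP=> /andP[_ kQ] _; rewrite (edegU_walk graph_edges walk_f).
have [q ->] : exists q, Q = q.*2 by exists Q./2; rewrite even_halfK.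
elim: q => [|q IH]; first by rewrite !big_geq.
rewrite doubleS big_mkcond !big_nat_recr //= -big_mkcond IH odd_double /=.
by rewrite addn0 addnA.
Qed.

Lemma edeg_walk_le : exists a, forall x, edeg e u x <= 1 + (x == a).
Proof.
have repeat1 i j : i < j -> j < Q -> w i = w j -> i <= 1.
  by move=> ij jQ wij; rewrite leqNgt; apply/negP => i1; exact: no_inner_repeat wij.
(* The first of two visits is at position 0 or 1. By [one_end_repeat], [w 1] can be chosen if it is
   revisited, and [w 0] otherwise. *)
have [a rep_a] : exists a, forall i j, i < j -> j < Q -> w i = w j -> w i = a.
  have [/existsP[[t tQ] /= /andP[t1 /eqP wt]]|no1] :=
    boolP [exists t : 'I_Q, (1 < t) && (w t == w 1)].
    exists (w 1) => -[|[|i]] j ij jQ wij //; last by have := repeat1 _ _ ij jQ wij.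
    by case: (@one_end_repeat j t) => //; rewrite ?t1 ?ij.
  exists (w 0) => -[|[|i]] j ij jQ wij //; last by have := repeat1 _ _ ij jQ wij.
  by case/existsP: no1; exists (Ordinal jQ); rewrite ij wij eqxx.
exists a => x; rewrite edeg_walk.
set A := [set k : 'I_Q | w k == x].
have le1 c : #|[set k in A | odd k == c]| <= 1.
  apply/card_le1_eqP => i j; rewrite !inE => /andP[/eqP wi /eqP oi] /andP[/eqP wj /eqP oj].
  apply/val_inj; have [ij|ji|//] := ltngtP (j : nat) i; exfalso.
    by apply: (@no_even_repeat j i) => //; rewrite ?oi ?wi.
  by apply: (@no_even_repeat i j) => //; rewrite ?oi ?wi.
have leA2 : #|A| <= 2.
  rewrite -(cardsID [set k : 'I_Q | odd k] A) -[2]/(1 + 1); apply: leq_add.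
    apply: leq_trans (le1 true); apply: subset_leq_card.
    by apply/subsetP => k; rewrite !inE eqb_id.
  apply: leq_trans (le1 false); apply: subset_leq_card.
  by apply/subsetP => k; rewrite !inE eqbF_neg andbC.
have [xa|x_a] := eqVneq x a; first by rewrite addn1.
rewrite addn0 leqNgt; apply/negP => /card_gt1P[i [j [iA jA neq_ij]]].
move: iA jA; rewrite !inE => /eqP wi /eqP wj; case/eqP: x_a.
have [ij|ji|/val_inj Eij] := ltngtP (i : nat) j.
- by rewrite -wi; apply: rep_a ij _ _; rewrite ?wi.
- by rewrite -wj; apply: rep_a ji _ _; rewrite ?wj.
- by rewrite Eij eqxx in neq_ij.
Qed.

End Positions.

(** The combinatorial core. Later arguments use this degree bound and no longer the walk. *)
Theorem minimal_binomial_edeg_le : exists a, forall x, edeg e u x <= 1 + (x == a).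
Proof.
have [E [uE vE E_top]] := minimal_binomial_top.
have [Q [w [f [[Q0 evQ] [closed f0] walk_f uw vw]]]] := minimal_binomial_walk uE vE E_top.
exact: (edeg_walk_le uE vE E_top Q0 evQ closed f0 walk_f uw vw).
Qed.

End Fixed.
End MinimalBinomials.

(** * Minimality of the support *)

Section MinimalSupport.
Variables (n m : nat) (e : m.-tuple {set 'I_n}).
Hypothesis graph_edges :
  forall k, exists x y : 'I_n, x != y /\ tnth e k = [set x; y].
Variables (u v : 'X_{1..m}) (a : 'I_n).
Hypothesis uv_min : minimal_binomial e u v.
Hypothesis edeg_u : forall x, edeg e u x <= 1 + (x == a).

Let uvE x : edeg e u x = edeg e v x. Proof. by case: uv_min. Qed.

(** Some end of the edge differs from [a] and has degree at most 1. *)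
Lemma edeg_squarefree w : edeg e w =1 edeg e u -> forall k, w k <= 1.
Proof.
move=> Ew k; have [x [y [xy Ek]]] := graph_edges k.
have le_w z : z \in tnth e k -> w k <= edeg e w z.
  by move=> zk; rewrite /edeg (bigD1 k) //= zk muln1 leq_addr.
have := le_w x; have := le_w y; rewrite !Ew Ek set21 set22.
have := edeg_u x; have := edeg_u y; case: (eqVneq x a) xy => [->|_ _]; last by lia.
by rewrite eq_sym => /negbTE->; lia.
Qed.

Let level (F : 'I_m -> int) (c : int) (w : 'X_{1..m}) : 'X_{1..m} :=
  [multinom (if F k == c then w k else 0) | k < m].

Let level_le F c w : (level F c w <= w)%MM.
Proof. by apply/mnm_lepP => k; rewrite mnmE; case: ifP. Qed.

(** All terms of the weighted sum are nonnegative, so a single linear equation tells whether the top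
    level carries the whole degree at [x]. *)
Let edeg_level F c (w : 'X_{1..m}) x : (forall k, 0 < w k -> (F k <= c)%R) ->
  (edeg e (level F c w) x == edeg e w x)
  = (\sum_k (c - F k) * Posz (w k * (x \in tnth e k)) == 0)%R.
Proof.
move=> leF; rewrite psumr_eq0 => [|k _]; last first.
  have [->|/leF Fk] := posnP (w k); first by rewrite mul0n mulr0.
  by rewrite mulr_ge0 // subr_ge0.
have term k : ((w - level F c w)%MM k * (x \in tnth e k) == 0)
    = ((c - F k) * Posz (w k * (x \in tnth e k)) == 0)%R.
  rewrite mnmBE mnmE mulf_eq0 subr_eq0 eqz_nat !muln_eq0 (eq_sym c).
  by case: ifP => _; rewrite ?subnn ?subn0.
have := edegD e (w - level F c w)%MM (level F c w) x.
rewrite submK // => ->; rewrite -[X in X == _]add0n eqn_add2r eq_sym sum_nat_eq0.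
apply/forallP/allP => H k; first by move=> _ /=; rewrite -term; exact: H.
by rewrite term; exact: (H k (mem_index_enum k)).
Qed.

(** The circuit property: on the support of the binomial, p - r is a multiple of u - v, and its zero
    at [k0] makes the multiple 0. *)
Lemma minimal_support (p r : 'X_{1..m}) k0 :
  edeg e p =1 edeg e r ->
  (forall k, 0 < p k + r k -> 0 < u k + v k) ->
  0 < u k0 + v k0 -> p k0 + r k0 = 0 -> p = r.
Proof.
move=> pr supp_pr uv_k0 pr_k0.
have coprime_uv := minimal_binomial_coprime uv_min.
have u1 := edeg_squarefree (fun x => erefl).
have v1 := edeg_squarefree (fun x => esym (uvE x)).
pose d k : int := (Posz (p k) - Posz (r k))%R.
(* F takes a constant value along the walk; its top level set {F = c} is
   shown to be balanced, hence everything. *)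
pose F k : int := if 0 < u k then d k else (- d k)%R.
have Fd k : (F k * (Posz (u k) - Posz (v k)))%R = d k.
  rewrite /F /d; have := supp_pr k; case: (coprime_uv k) => ->.
    by have := v1 k; case: (v k) => [|[|//]] _ /=; lia.
  by have := u1 k; case: (u k) => [|[|//]] _ /=; lia.
have [i Pi max_i] := @Order.TotalTheory.arg_maxP _ _ _ k0 (fun k => 0 < u k + v k) F uv_k0.
set c := F i in max_i.
have leu k : 0 < u k -> (F k <= c)%R by move=> uk; apply: max_i; rewrite addn_gt0 uk.
have lev k : 0 < v k -> (F k <= c)%R by move=> vk; apply: max_i; rewrite addn_gt0 vk orbT.
pose uc := level F c u; pose vc := level F c v.
have uc_le : (uc <= u)%MM by exact: level_le.
have vc_le : (vc <= v)%MM by exact: level_le.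
have big_Posz x (z : 'X_{1..m}) :
    Posz (edeg e z x) = (\sum_k Posz (z k) * Posz (x \in tnth e k))%R.
  by rewrite /edeg (big_morph Posz PoszD (erefl 0%R)).
have sum_d x : (\sum_k d k * Posz (x \in tnth e k) = 0)%R.
  under eq_bigr do rewrite mulrBl.
  by rewrite sumrB -!big_Posz pr subrr.
(* The weighted sums for [u] and [v] differ by c times the difference of their degrees at [x], minus
   the sum of [d] around [x]; both vanish. *)
have tight x : (edeg e uc x == edeg e u x) = (edeg e vc x == edeg e v x).
  rewrite !edeg_level //; congr (_ == _); apply/eqP; rewrite -subr_eq0 -sumrB.
  have -> : (\sum_k ((c - F k) * Posz (u k * (x \in tnth e k))
                    - (c - F k) * Posz (v k * (x \in tnth e k)))
      = \sum_k (c * (Posz (u k) * Posz (x \in tnth e k))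
               - c * (Posz (v k) * Posz (x \in tnth e k))
               - d k * Posz (x \in tnth e k)))%R.
    by apply: eq_bigr => k _; rewrite -Fd !PoszM; ring.
  by rewrite !sumrB -!mulr_sumr -!big_Posz uvE sum_d !subrr.
(* Away from [a] the degree of a level part is 0 or full, so [tight] decides it. *)
have uv_c x : x != a -> edeg e uc x = edeg e vc x.
  move=> xa; have := edeg_u x; rewrite (negbTE xa).
  have := edeg_le e x uc_le; have := edeg_le e x vc_le; have := tight x; have := uvE x.
  lia.
(* At the exceptional vertex a, where degree 2 is possible, parity helps. *)
have E_c : edeg e uc =1 edeg e vc.
  move=> x; have [->{x}|/uv_c//] := eqVneq x a.
  have [S Sv Su] : exists2 S, edeg e vc a + S = (mdeg vc).*2
                            & edeg e uc a + S = (mdeg uc).*2.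
    exists (\sum_(x | x != a) edeg e vc x);
      rewrite -(sum_edeg graph_edges) [RHS](bigD1 a) //=.
    by rewrite (eq_bigr _ uv_c).
  have := edeg_u a; rewrite eqxx.
  have := edeg_le e a uc_le; have := edeg_le e a vc_le; have := tight a; have := uvE a.
  lia.
have [uc0|ucu] := minimal_binomial_primitive uv_min uc_le vc_le E_c.
  have vc0 : vc = 0%MM.
    apply/eqP; rewrite -mdeg_eq0 -(eq_edeg_mdeg graph_edges E_c) uc0.
    by rewrite mdeg0.
  have /mnmP/(_ i) := uc0; have /mnmP/(_ i) := vc0.
  by rewrite !mnmE eqxx; move: Pi; lia.
have vcv : vc = v.
  by apply: (eq_edeg_le graph_edges vc_le) => x; rewrite -E_c ucu uvE.
have Fc k : 0 < u k + v k -> F k = c.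
  move=> uvk; apply/eqP; apply: contraTT uvk => Fk.
  have /mnmP/(_ k) := ucu; have /mnmP/(_ k) := vcv.
  by rewrite !mnmE (negbTE Fk) => <- <-.
have d_k0 : d k0 = 0 by rewrite /d; lia.
have c0 : c = 0 by rewrite -(Fc k0) // /F d_k0 oppr0; case: ifP.
apply/mnmP => k; have [uvk|] := boolP (0 < u k + v k).
  by have := Fd k; rewrite (Fc _ uvk) c0 mul0r /d; lia.
by have := supp_pr k; lia.
Qed.

End MinimalSupport.

Local Open Scope ring_scope.

(** * Monomial ideals and the toric ideal *)

Section IdealGen.
Variable R : comNzRingType.
Implicit Types (A : R -> Prop) (p q f : R).

Lemma ideal_gen_mem A f : A f -> ideal_gen A f.
Proof.
move=> Af; exists [:: (1, f)]; rewrite big_seq1 mul1r.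
by split=> // x; rewrite inE => /eqP->.
Qed.

Lemma ideal_gen0 A : ideal_gen A 0.
Proof. by exists [::]; rewrite big_nil. Qed.

Lemma ideal_genD A p q : ideal_gen A p -> ideal_gen A q -> ideal_gen A (p + q).
Proof.
move=> [s [sA ->]] [t [tA ->]]; exists (s ++ t); rewrite big_cat; split=> // x.
by rewrite mem_cat => /orP[/sA|/tA].
Qed.

Lemma ideal_genM A p q : ideal_gen A q -> ideal_gen A (p * q).
Proof.
move=> [s [sA ->]]; exists [seq (p * x.1, x.2) | x <- s]; split.
  by move=> _ /mapP[x xs ->] /=; exact: (sA _ xs).
by rewrite big_map mulr_sumr; apply: eq_bigr => x _; rewrite mulrA.
Qed.

End IdealGen.

Section MonomialIdeals.
Variables (K : fieldType) (n : nat).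
Implicit Types (A : {mpoly K[n]} -> Prop) (p : {mpoly K[n]}).

Lemma msupp_ideal_gen A p w : ideal_gen A p -> w \in msupp p ->
  exists f g, A f /\ w \in msupp (g * f).
Proof.
move=> [s [sA ->]] /msupp_sum_le /flatten_mapP[[g f] xs wx].
rewrite filter_predT in xs.
by exists f, g; split=> //; exact: (sA _ xs).
Qed.

Lemma msuppMX_le p (w s : 'X_{1..n}) : s \in msupp (p * 'X_[w]) -> (w <= s)%MM.
Proof.
move/msuppM_le/allpairsP => [[a b] /= [_ + ->]].
by rewrite msuppX inE => /eqP->; exact: lem_addl.
Qed.

Lemma ideal_gen_monomial (W : 'X_{1..n} -> Prop) A p s :
  (forall f, A f -> exists2 w, W w & f = 'X_[w]) ->
  ideal_gen A p -> s \in msupp p -> exists2 w, W w & (w <= s)%MM.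
Proof.
move=> AW /msupp_ideal_gen gen /gen[f [g [/AW[w Ww ->] /msuppMX_le]]].
by exists w.
Qed.

Lemma monomial_dvd (w s : 'X_{1..n}) : (w <= s)%MM ->
  'X_[s] = 'X_[s - w] * 'X_[w] :> {mpoly K[n]}.
Proof. by move=> le_ws; rewrite -mpolyXD submK. Qed.

Lemma mpolyX_inj (w s : 'X_{1..n}) : 'X_[w] = 'X_[s] :> {mpoly K[n]} -> w = s.
Proof.
move=> Ews; apply/eqP; have := mcoeffX K w w; rewrite Ews mcoeffX eqxx eq_sym.
by case: eqP => // _ /eqP; rewrite eq_sym oner_eq0.
Qed.

End MonomialIdeals.

Section Toric.
Variables (K : fieldType) (n m : nat) (e : m.-tuple {set 'I_n}).
Local Notation T := {mpoly K[m]}.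
Local Notation I_G := (toric_ideal K e).

Definition set_mnm (S : {set 'I_n}) : 'X_{1..n} := (\sum_(x in S) U_(x))%MM.

Lemma set_mnmE S x : set_mnm S x = (x \in S).
Proof.
rewrite mnm_sumE big_mkcond (bigD1 x) //= mnm1E eqxx big1.
  by rewrite addn0; case: (x \in S).
by move=> y /negbTE yx; rewrite mnm1E yx; case: ifP.
Qed.

Lemma edge_monomialE S : edge_monomial K S = 'X_[set_mnm S].
Proof. exact: mprodXE. Qed.

Definition image_mnm (u : 'X_{1..m}) : 'X_{1..n} := [multinom edeg e u x | x < n].

Lemma image_mnm_eq u v : image_mnm u = image_mnm v <-> edeg e u =1 edeg e v.
Proof.
split=> [/mnmP E x|E]; first by have := E x; rewrite !mnmE.
by apply/mnmP => x; rewrite !mnmE E.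
Qed.

Lemma toric_map_monomial u :
  'X_[u] \mPo [tuple edge_monomial K (tnth e k) | k < m] = 'X_[image_mnm u].
Proof.
rewrite comp_mpolyX; under eq_bigr do rewrite tnth_mktuple edge_monomialE.
rewrite mprodXnE; congr 'X_[_]; apply/mnmP => x.
rewrite mnm_sumE mnmE; apply: eq_bigr => k _.
by rewrite mulmnE set_mnmE mulnC.
Qed.

Lemma toric_binomial u v : I_G ('X_[u] - 'X_[v]) <-> edeg e u =1 edeg e v.
Proof.
rewrite /toric_ideal raddfB /= !toric_map_monomial -image_mnm_eq.
split=> [/eqP|->]; last by rewrite subrr.
by rewrite subr_eq0 => /eqP/mpolyX_inj.
Qed.

(** The image of y^u must be cancelled by the image of another term. *)
Lemma toric_partner p u : I_G p -> u \in msupp p ->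
  exists v, [/\ v \in msupp p, v != u & edeg e u =1 edeg e v].
Proof.
move=> Ip up.
have : exists v, [&& v \in msupp p, v != u & image_mnm u == image_mnm v].
  suff /hasP[v vp /andP[vu Euv]] :
      has (fun v => (v != u) && (image_mnm u == image_mnm v)) (msupp p).
    by exists v; rewrite vp vu.
  apply: contraLR up => /hasPn no; rewrite -mcoeff_eq0.
  have : (p \mPo [tuple edge_monomial K (tnth e k) | k < m])@_(image_mnm u) = 0.
    by move: Ip; rewrite /toric_ideal => ->; rewrite mcoeff0.
  rewrite comp_mpolyEX raddf_sum /=.
  have [up|/memN_msupp_eq0->//] := boolP (u \in msupp p).
  rewrite (bigD1_seq u) //= big_seq_cond big1.
    by rewrite addr0 toric_map_monomial mcoeffZ mcoeffX eqxx mulr1 => ->.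
  move=> v /andP[/no + vu]; rewrite vu /= => /negbTE Ev.
  by rewrite toric_map_monomial mcoeffZ mcoeffX eq_sym Ev mulr0.
by case=> v /and3P[vp vu /eqP/image_mnm_eq Euv]; exists v.
Qed.

Lemma toric_subM p q r : I_G p -> I_G q -> I_G (p - r * q).
Proof.
by rewrite /toric_ideal comp_mpolyB rmorphM /= => -> ->; rewrite mulr0 subr0.
Qed.

Lemma toric_gen p : ideal_gen I_G p -> I_G p.
Proof.
case=> s [sI ->]; rewrite /toric_ideal raddf_sum /= big_seq big1 // => x /sI Ix.
by rewrite rmorphM /= [X in _ * X]Ix mulr0.
Qed.

End Toric.

(** * Linear quotients in terms of edges *)

Section LinearQuotients.
Variables (K : fieldType) (n m : nat) (e : m.-tuple {set 'I_n}).
Hypothesis graph_edges :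
  forall k, exists x y : 'I_n, x != y /\ tnth e k = [set x; y].
Hypothesis e_uniq : uniq e.

(** For k < l the monomial of [e_k] lies in the colon ideal, so some linear generator [f] has a term
    x dividing it. The product of x and the monomial of [e_l] occurs in an element of a monomial
    ideal, so an earlier edge monomial divides it; that edge joins x to an end of [e_l]. *)
Lemma linear_quotients_edges (I : {mpoly K[n]} -> Prop) :
  linear_quotient_ordering I [tuple edge_monomial K (tnth e k) | k < m] ->
  forall k l : 'I_m, [disjoint tnth e k & tnth e l] ->
  exists (j : 'I_m) (x y : 'I_n),
    [/\ (j < maxn k l)%N, x \in tnth e k, y \in tnth e l & tnth e j = [set x; y]].
Proof.
move=> [_ _ colon].
have main (k l : 'I_m) : (k < l)%N -> [disjoint tnth e k & tnth e l] ->
  exists (j : 'I_m) (x y : 'I_n),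
    [/\ (j < l)%N, x \in tnth e k, y \in tnth e l & tnth e j = [set x; y]].
  move=> kl dis_kl.
  have [A A1 colonA] := colon l (leq_ltn_trans (leq0n k) kl).
  set J := ideal_gen _ in colonA.
  have : ideal_gen A (edge_monomial K (tnth e k)).
    apply/colonA; rewrite /colon_ideal tnth_mktuple mulrC.
    apply/ideal_genM/ideal_gen_mem.
    by exists k => //; rewrite tnth_mktuple.
  rewrite edge_monomialE => gen_k.
  have := msupp_ideal_gen (w := set_mnm (tnth e k)) gen_k.
  rewrite msuppX inE eqxx => /(_ isT)[f [g [Af]]].
  move=> /msuppM_le/allpairsP[[s t] /= [_ tf Est]].
  have /dhomogP/(_ t tf) := A1 f Af; move=> /eqP /mdeg1P [x /eqP Et].
  have xk : x \in tnth e k.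
    have /mnmP/(_ x) := Est; rewrite set_mnmE mnmDE Et mnm1E eqxx.
    by case: (x \in _); lia.
  have : J (f * edge_monomial K (tnth e l)).
    by have := (colonA f).2 (ideal_gen_mem Af); rewrite /colon_ideal tnth_mktuple.
  move=> Jf.
  have tl : (set_mnm (tnth e l) + t)%MM \in msupp (f * edge_monomial K (tnth e l)).
    by rewrite mcoeff_msupp edge_monomialE mcoeffMX -mcoeff_msupp.
  have [w [j jl ->] /mnm_lepP le_w] :
      exists2 w, (exists2 j : 'I_m, (j < l)%N & w = set_mnm (tnth e j))
               & (w <= set_mnm (tnth e l) + t)%MM.
    apply: ideal_gen_monomial Jf tl => _ [j jl ->]; rewrite tnth_mktuple edge_monomialE.
    by exists (set_mnm (tnth e j)) => //; exists j.
  have sub z : z \in tnth e j -> z != x -> z \in tnth e l.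
    move=> zj zx; have := le_w z; rewrite mnmDE !set_mnmE zj Et mnm1E eq_sym (negbTE zx).
    by case: (z \in _).
  have card2 i : #|tnth e i| = 2.
    by have [b [c [bc ->]]] := graph_edges i; rewrite cards2 bc.
  (* Otherwise [e_j] would be contained in [e_l], hence equal to it, although j < l. *)
  have xj : x \in tnth e j.
    apply/negPn/negP => xj.
    have Ejl : tnth e j = tnth e l.
      apply/eqP; rewrite eqEcard !card2 leqnn andbT; apply/subsetP => z zj.
      by apply: sub => //; apply: contraNneq xj => <-.
    by move/tuple_uniqP: e_uniq => /(_ _ _ Ejl) Ej; rewrite Ej ltnn in jl.
  have [y xy Ej] := edge_end graph_edges xj.
  exists j, x, y; split=> //; apply: sub; last by rewrite eq_sym.
  by rewrite Ej set22.
move=> k l dis; have [kl|lk|/val_inj kl] := ltngtP k l.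
- exact: main.
- have [] := main l k lk; first by rewrite disjoint_sym.
  by move=> j [x [y [jk xl yk Ej]]]; exists j, y, x; split=> //; rewrite setUC.
- have [x [y [_ Ek]]] := graph_edges k; move: dis.
  by rewrite -kl disjoints_subset => /subsetP/(_ x); rewrite Ek !inE eqxx => /(_ isT).
Qed.

End LinearQuotients.

Lemma linear_poly_coef (R : comNzRingType) (P : {poly R}) (q a b : R) :
  P * q%:P = 'X * a%:P - b%:P -> P`_1 * q = a /\ P`_0 * q = - b.
Proof.
move=> EP; rewrite -!coefMC EP !coefB !coefXM !coefC /=.
by rewrite subr0 sub0r.
Qed.

Lemma size_mul_eq2 (R : idomainType) (P Q : {poly R}) :
  size (P * Q) = 2%N -> size P = 1%N \/ size Q = 1%N.
Proof.
move=> PQ2; have := size_poly_eq0 (P * Q); rewrite PQ2 mulf_eq0 => /esym/norP[P0 Q0].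
have := size_mul P0 Q0; rewrite PQ2; rewrite -!size_poly_gt0 in P0 Q0.
by lia.
Qed.

Lemma size_mul_1 (R : idomainType) (P Q : {poly R}) : P * Q = 1 -> size Q = 1%N.
Proof.
move=> PQ; have /eqP : size (P * Q) = 1%N by rewrite PQ size_poly1.
by rewrite size_mul_eq1 => /andP[_ /eqP].
Qed.

(** * Irreducibility of binomials *)

Section Irreducibility.
Variables (K : fieldType) (m : nat).
Local Notation T := {mpoly K[m]}.

Lemma mpolyX_dvd_subst0 (k : 'I_m) (p : T) :
  p \mPo [tuple if i == k then 0 else 'X_i | i < m] = 0 -> exists q, p = q * 'X_k.
Proof.
move=> p0; pose rho (p : T) := p \mPo [tuple if i == k then 0 else 'X_i | i < m].
pose q (s : 'X_{1..m}) : T := if s k == 0 then 0 else 'X_[s - U_(k)].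
have qE s : 'X_[s] - rho 'X_[s] = q s * 'X_k.
  rewrite /rho comp_mpolyX /q; under eq_bigr do rewrite tnth_mktuple.
  have [sk|sk] := eqVneq (s k) 0%N.
    rewrite mul0r mpolyXE_id; apply/eqP; rewrite subr_eq0; apply/eqP.
    by apply: eq_bigr => i _; case: eqP => // ->; rewrite sk !expr0.
  rewrite (bigD1 k) //= eqxx expr0n (negbTE sk) mul0r subr0.
  by rewrite -mpolyXD submK // lep1mP.
exists (\sum_(s <- msupp p) p@_s *: q s).
rewrite -[LHS]subr0 -[X in _ - X]p0 {1}[p]mpolyE comp_mpolyEX -sumrB mulr_suml.
by apply: eq_bigr => s _; rewrite -scalerBr -scalerAl -qE.
Qed.

(** Substituting 0 for y_k is a ring map into a domain with kernel generated by y_k. *)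
Lemma mpolyX_prime (k : 'I_m) (p q r : T) : p * q = r * 'X_k ->
  (exists p', p = p' * 'X_k) \/ (exists q', q = q' * 'X_k).
Proof.
move=> /(congr1 (comp_mpoly [tuple if i == k then 0 else 'X_i | i < m])).
rewrite !rmorphM /= comp_mpolyXU -tnth_nth tnth_mktuple eqxx mulr0 => /eqP.
by rewrite mulf_eq0 => /orP[]/eqP/mpolyX_dvd_subst0; [left | right].
Qed.

Lemma dvd_monomial (w : 'X_{1..m}) (p q : T) : p * q = 'X_[w] ->
  q \is a GRing.unit \/ exists k, (0 < w k)%N /\ exists q', q = q' * 'X_k.
Proof.
have [N] := ubnP (mdeg w); elim: N w p => // N IH w p ltN pq.
have [w0|] := eqVneq w 0%MM.
  by left; apply/unitrP; exists p; rewrite [q * p]mulrC pq w0 mpolyX0.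
rewrite -mdeg_eq0 mdegE sum_nat_eq0 negb_forall => /existsP[k /= wk].
have le_kw : (U_(k) <= w)%MM by rewrite lep1mP.
have wE : 'X_[w] = 'X_[w - U_(k)] * 'X_k :> T by exact: monomial_dvd.
have [[p' Ep]|dvd_q] := mpolyX_prime (etrans pq wE); last first.
  by right; exists k; rewrite lt0n.
have Xk0 : 'X_k != 0 :> T by rewrite -msupp_eq0 msuppX.
have p'q : p' * q = 'X_[w - U_(k)].
  by apply: (mulIf Xk0); rewrite -wE -pq Ep mulrAC.
have [||[j [wj dvd_j]]] := IH _ _ _ p'q; [|by left|].
  by move: ltN; rewrite -{1}(submK le_kw) mdegD mdeg1; lia.
by right; exists j; split=> //; move: wj; rewrite mnmBE; lia.
Qed.

Lemma coprime_monomials_dvd (u v : 'X_{1..m}) (p q r : T) :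
  (forall k, u k = 0%N \/ v k = 0%N) ->
  p * r = 'X_[u] -> q * r = - 'X_[v] -> r \is a GRing.unit.
Proof.
move=> coprime_uv pr qr; have [//|[k [uk [r' Er]]]] := dvd_monomial pr.
have vk : (U_(k) <= v)%MM.
  apply: (@msuppMX_le K _ (- q * r')); rewrite -mulrA -Er mulNr qr opprK.
  by rewrite msuppX mem_head.
by move: vk; rewrite lep1mP; case: (coprime_uv k) => Ek; lia.
Qed.

Section LinearVariable.
Variable E : 'I_m.

(* View polynomials as polynomials in the variable y_E. *)
Let psi : T -> {poly T} :=
  mmap (polyC \o @mpolyC m K) (fun k => if k == E then 'X else ('X_k)%:P).

Let psiB : {morph psi : p q / p - q}. Proof. exact: mmapB. Qed.

Let psiM : {morph psi : p q / p * q}.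
Proof. by move=> p q; rewrite /psi rmorphM. Qed.

Let psiX (s : 'X_{1..m}) : psi 'X_[s] = 'X^(s E) * ('X_[s - U_(E) *+ s E])%:P.
Proof.
rewrite /psi mmapX /mmap1 (bigD1 E) //= eqxx; congr (_ * _).
rewrite mpolyXE_id rmorph_prod [RHS](bigD1 E) //= mnmBE mulmnE mnm1E eqxx mul1n subnn.
rewrite expr0 mul1r; apply: eq_bigr => k kE.
by rewrite (negbTE kE) mnmBE mulmnE mnm1E eq_sym (negbTE kE) mul0n subn0 rmorphXn.
Qed.

Let psiK (p : T) : (psi p).['X_E] = p.
Proof.
rewrite /psi {2}[p]mpolyE {1}[p]mpolyE raddf_sum /= horner_sum; apply: eq_bigr => s _.
rewrite mmapZ -/(psi _) psiX /= hornerCM hornerM hornerXn hornerC mul_mpolyC.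
rewrite mpolyXn -mpolyXD; congr (_ *: 'X_[_]); apply/mnmP => k.
rewrite mnmDE mnmBE mulmnE mnm1E; case: eqP => [->|_]; lia.
Qed.

(** The binomial has degree 1 in y_E, so one factor is free of y_E. It divides both coefficients,
    which are coprime monomials up to sign, and is therefore a unit. *)
Lemma binomial_irreducible (u v : 'X_{1..m}) : u E = 1%N -> v E = 0%N ->
  (forall k, u k = 0%N \/ v k = 0%N) -> irreducible ('X_[u] - 'X_[v] : T).
Proof.
move=> uE vE coprime_uv; set b := _ - _.
have b_u : b@_u = 1.
  by rewrite mcoeffB !mcoeffX eqxx; case: eqP => [vu|]; [rewrite -vu vE in uE | rewrite subr0].
have b0 : b != 0 by apply: contraNneq (oner_neq0 K) => b0; rewrite -b_u b0 mcoeff0.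
have main (p q : T) : b = p * q -> size (psi q) = 1%N -> q \is a GRing.unit.
  move=> bpq /eqP/size_poly1P[c _ qc].
  (* Evaluating the constant [psi q] at y_E identifies it with [q]. *)
  have {}qc : psi q = q%:P by rewrite -[in RHS](psiK q) qc hornerC.
  have Epq : psi p * q%:P = 'X * ('X_[u - U_(E)])%:P - ('X_[v])%:P.
    rewrite -qc -psiM -bpq psiB !psiX uE vE expr0 expr1 mul1r mulm1n mulm0n.
    by rewrite subm0.
  have [p1 p0] := linear_poly_coef Epq.
  apply: coprime_monomials_dvd p1 p0 => k.
  by rewrite mnmBE; case: (coprime_uv k) => ->; [left | right].
have b_size : size (psi b) = 2%N.
  rewrite psiB !psiX uE vE expr0 expr1 mul1r mulrC -polyCN size_MXaddC size_polyC.
  by rewrite polyC_eq0 -msupp_eq0 msuppX.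
split=> //.
- apply/negP => /unitrP[c [/(congr1 psi)]]; rewrite psiM.
  have -> : psi 1 = 1 by rewrite /psi rmorph1.
  by move/size_mul_1; rewrite b_size.
move=> p q bpq; move: (b_size); rewrite bpq psiM => /size_mul_eq2[sp|sq].
  by left; apply: (main q p); rewrite // mulrC.
by right; apply: (main p q).
Qed.

End LinearVariable.
End Irreducibility.

(** * Circuits and reduced Groebner bases *)

Section Circuits.
Variables (K : fieldType) (n m : nat) (e : m.-tuple {set 'I_n}).
Local Notation T := {mpoly K[m]}.
Local Notation I_G := (toric_ideal K e).
Hypothesis graph_edges :
  forall k, exists x y : 'I_n, x != y /\ tnth e k = [set x; y].
Hypothesis linear_quotients : forall k l : 'I_m,
  [disjoint tnth e k & tnth e l] ->
  exists (j : 'I_m) (x y : 'I_n),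
    [/\ (j < maxn k l)%N, x \in tnth e k, y \in tnth e l & tnth e j = [set x; y]].

Lemma msupp_binomial (u v : 'X_{1..m}) : u != v ->
  forall w, (w \in msupp ('X_[u] - 'X_[v] : T)) = (w == u) || (w == v).
Proof.
move=> uv w; rewrite mcoeff_msupp mcoeffB !mcoeffX (eq_sym u) (eq_sym v).
case: (eqVneq w u) => [->|_]; first by rewrite (negbTE uv) subr0 oner_eq0.
by case: (eqVneq w v) => _ /=; [rewrite sub0r oppr_eq0 oner_eq0 | rewrite subrr eqxx].
Qed.

Lemma bsupp_binomial (u v : 'X_{1..m}) : u != v ->
  forall k, (k \in bsupp ('X_[u] - 'X_[v] : T)) = (0 < u k + v k)%N.
Proof.
move=> uv k; rewrite inE addn_gt0 !lt0n; apply/hasP/orP.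
  by case=> w; rewrite msupp_binomial // => /orP[]/eqP->; [left | right].
by case=> [uk|vk]; [exists u | exists v]; rewrite ?msupp_binomial // eqxx ?orbT.
Qed.

Lemma minimal_binomial_neq (u v : 'X_{1..m}) : minimal_binomial e u v -> u != v.
Proof. by case=> _ + _; apply: contraTneq => ->; rewrite lex_ltxx. Qed.

Theorem minimal_binomial_circuit (u v : 'X_{1..m}) :
  minimal_binomial e u v -> is_circuit I_G ('X_[u] - 'X_[v]).
Proof.
move=> uv_min; have uv := minimal_binomial_neq uv_min.
have [a edeg_u] := minimal_binomial_edeg_le graph_edges linear_quotients uv_min.
have [E [uE vE _]] := minimal_binomial_top uv_min.
have Euv : edeg e u =1 edeg e v by case: uv_min.
split.
- by exists u, v.
- exact/toric_binomial.
- apply: (@binomial_irreducible K m E) => //.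
    by have := edeg_squarefree graph_edges edeg_u (fun x => erefl) E; lia.
  exact: minimal_binomial_coprime uv_min.
case=> b [[p [r ->]] pr0 /toric_binomial Epr /properP[/subsetP sub [k0 k0_uv k0_pr]]].
have pr : p != r by apply: contraNneq pr0 => ->; rewrite subrr.
case/eqP: (pr); apply: (minimal_support graph_edges uv_min edeg_u (k0 := k0)) => //.
- by move=> k; have := sub k; rewrite !bsupp_binomial.
- by move: k0_uv; rewrite bsupp_binomial.
by move: k0_pr; rewrite bsupp_binomial // -eqn0Ngt => /eqP.
Qed.

(** Outer induction on the degree, inner induction on the leading monomial. If a binomial of the
    ideal has a leading monomial properly dividing y^u, a multiple of it rewrites y^u to a smaller
    y^v2; otherwise the binomial is a circuit. *)
Lemma ideal_gen_binomial (u v : 'X_{1..m}) : edeg e u =1 edeg e v ->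
  ideal_gen (is_circuit I_G) ('X_[u] - 'X_[v]).
Proof.
have [N] := ubnP (mdeg u); elim: N u v => // N IHN u0 v0 ltN Euv0.
pose d := mdeg u0.
(* Only finitely many monomials have degree at most [d], so counting those below [u] measures the
   inner induction. *)
pose rank (u : 'X_{1..m}) := #|[set w : 'X_{1..m < d.+1} | lex_lt w u]|.
have rank_lt u v : mdeg v = d -> lex_lt v u -> (rank v < rank u)%N.
  move=> dv vu; apply: proper_card; apply/properP; split.
    by apply/subsetP => w; rewrite !inE => /lex_lt_trans; apply.
  have dv' : (mdeg v < d.+1)%N by rewrite dv.
  by exists (BMultinom dv'); rewrite !inE ?lex_ltxx.
have desc u v : mdeg u = d -> edeg e u =1 edeg e v -> lex_lt v u ->
    ideal_gen (is_circuit I_G) ('X_[u] - 'X_[v]).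
  have [M] := ubnP (rank u); elim: M u v => // M IHM u v ltM du Euv vu.
  have dv : mdeg v = d by rewrite -(eq_edeg_mdeg graph_edges Euv).
  pose reducible (z : 'X_{1..m < d.+1} * 'X_{1..m < d.+1}) :=
    [&& (z.1 <= u)%MM, image_mnm e z.1 == image_mnm e z.2, lex_lt z.2 z.1
      & z.1 != u :> 'X_{1..m}].
  have [/existsP[[[u1 d1] [v1 d1']]]|irred] := boolP [exists z, reducible z].
    case/and4P=> /= le_u /eqP/image_mnm_eq E1 lt1 neq_u.
    have gen1 : ideal_gen (is_circuit I_G) ('X_[u1] - 'X_[v1]).
      apply: IHN E1; move: ltN; rewrite -/d -du -{1}(submK le_u) mdegD.
      suff : mdeg (u - u1)%MM != 0%N by lia.
      by rewrite mdeg_eq0; apply: contra neq_u => /eqP u0E;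
        rewrite -(submK le_u) u0E add0m.
    pose v2 := (v1 + (u - u1))%MM.
    have gen2 : ideal_gen (is_circuit I_G) ('X_[u] - 'X_[v2]).
      have := ideal_genM 'X_[u - u1] gen1.
      by rewrite mulrBr -!mpolyXD submK // addmC.
    have lt2 : lex_lt v2 u.
      by rewrite -[X in lex_lt _ X](submK le_u) [X in lex_lt _ X]addmC lex_ltD2r.
    have E2 : edeg e v2 =1 edeg e u.
      by move=> x; rewrite /v2 edegD -E1 -edegD addmC submK.
    have d2 : mdeg v2 = d by rewrite (eq_edeg_mdeg graph_edges E2).
    have -> : 'X_[u] - 'X_[v] = ('X_[u] - 'X_[v2]) + ('X_[v2] - 'X_[v]) :> T.
      by rewrite addrA subrK.
    apply: ideal_genD => //; have [->|v2v] := eqVneq v2 v.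
      by rewrite subrr; exact: ideal_gen0.
    (* Both [v2] and [v] lie below [u], so the inner induction applies whichever is larger. *)
    have [lt_v|lt_v] := orP (lex_lt_total v2v); last first.
      apply: IHM => // [|x]; last by rewrite E2 Euv.
      by apply: leq_trans (rank_lt _ _ d2 lt2) _; rewrite -ltnS.
    rewrite -[_ - _]opprB -mulN1r; apply: ideal_genM.
    apply: IHM => // [|x]; last by rewrite E2 Euv.
    by apply: leq_trans (rank_lt _ _ dv vu) _; rewrite -ltnS.
  apply: ideal_gen_mem; apply: minimal_binomial_circuit; split=> // u1 v1 le_u E1 lt1.
  apply/eqP; apply: contraNT irred => neq_u.
  have d1 : (mdeg u1 < d.+1)%N by rewrite ltnS -du -(submK le_u) mdegD leq_addl.
  have d1' : (mdeg v1 < d.+1)%N by rewrite -(eq_edeg_mdeg graph_edges E1).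
  apply/existsP; exists (BMultinom d1, BMultinom d1'); apply/and4P; split=> //=.
  by apply/eqP/image_mnm_eq.
have [->|uv] := eqVneq u0 v0; first by rewrite subrr; exact: ideal_gen0.
have [lt_u|lt_v] := orP (lex_lt_total uv); last exact: desc.
rewrite -[_ - _]opprB -mulN1r; apply: ideal_genM; apply: desc => //.
by rewrite -(eq_edeg_mdeg graph_edges Euv0).
Qed.

(** Subtracting a multiple of y^u - y^v, with [v] a partner of [u] in [p], removes the term at [u]
    and adds none, so the number of terms drops. *)
Theorem toric_ideal_circuits (p : T) : I_G p <-> ideal_gen (is_circuit I_G) p.
Proof.
split; last by case=> s [sC ->]; apply: toric_gen; exists s; split=> // x /sC[].
have [N] := ubnP (size (msupp p)); elim: N p => // N IH p ltN Ip.
have [->|] := eqVneq p 0; first exact: ideal_gen0.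
rewrite -msupp_eq0; case Ep : (msupp p) => [//|u s] _.
have up : u \in msupp p by rewrite Ep mem_head.
have [v [vp vu Euv]] := toric_partner Ip up.
pose b : T := 'X_[u] - 'X_[v].
have Ib : I_G b by apply/toric_binomial.
rewrite -[p](subrK ((p@_u)%:MP * b)); apply: ideal_genD; last first.
  exact/ideal_genM/ideal_gen_binomial.
apply: IH; last exact: toric_subM.
rewrite ltnS in ltN; apply: leq_trans ltN; rewrite Ep /= ltnS.
apply: uniq_leq_size (msupp_uniq _) _ => w.
rewrite mcoeff_msupp mcoeffB mul_mpolyC mcoeffZ mcoeffB !mcoeffX.
have [<-|wu] := eqVneq u w.
  by rewrite (negbTE vu) subr0 mulr1 subrr eqxx.
have : w \in msupp p -> w \in s.
  by rewrite Ep inE eq_sym (negbTE wu).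
have [<- /(_ vp)//|_] := eqVneq v w.
by rewrite subrr mulr0 subr0 -mcoeff_msupp.
Qed.

(** A partner of the leading monomial [u] serves as [v]. Minimal generation of the initial ideal
    gives minimality of [u], and reducedness excludes further terms. *)
Lemma reduced_groebner_minimal (B : seq T) g :
  reduced_groebner_basis (@lex_lt m) I_G B -> g \in B ->
  exists u v, minimal_binomial e u v /\ g = 'X_[u] - 'X_[v].
Proof.
move=> [B_I B_monic [B_gen B_min] _ B_red] gB.
have [u [ug lead_u] gu1] := B_monic g gB; have Ig := B_I g gB.
have initial u1 v1 : edeg e u1 =1 edeg e v1 -> lex_lt v1 u1 ->
    initial_ideal (@lex_lt m) I_G 'X_[u1].
  move=> E1 lt1; have neq1 : u1 != v1 by apply: contraTneq lt1 => ->; rewrite lex_ltxx.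
  apply: ideal_gen_mem; exists ('X_[u1] - 'X_[v1]), u1; split=> //.
    exact/toric_binomial.
  split; first by rewrite msupp_binomial ?eqxx.
  by move=> w; rewrite msupp_binomial // => /orP[]/eqP->; rewrite ?eqxx.
have [v [vg vu Euv]] := toric_partner Ig ug.
exists u, v; split.
  split=> // [|u1 v1 le_u E1 lt1]; first exact: lead_u.
  apply/eqP/negPn/negP => neq_u.
  have := (B_gen _).1 (initial _ _ E1 lt1).
  move/(ideal_gen_monomial (W := fun w => exists2 g', g' \in B & is_lead (@lex_lt m) g' w)).
  case/(_ u1) => [_ [g' [w [g'B g'w ->]]]||w [g' g'B g'w] le_w].
  - by exists w => //; exists g'.
  - by rewrite msuppX mem_head.
  apply: (B_min 'X_[u]); first by exists g, u; split.
  rewrite [X in ideal_gen _ X](monomial_dvd K (lepm_trans le_w le_u)); apply: ideal_genM.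
  apply: ideal_gen_mem; split; first by exists g', w.
  move/mpolyX_inj => Ewu; case/negP: neq_u; apply/eqP/mnmP => k.
  have := mnm_lepP le_w k; have := mnm_lepP le_u k; rewrite Ewu; lia.
(* If [q] were nonzero, two of its monomials would have the same image and the larger would lie in
   the initial ideal; but the monomials of [q] are trailing monomials of [g]. *)
apply/eqP; rewrite -subr_eq0 -msupp_eq0; set q := g - _.
case Eq : (msupp q) => [//|w s]; have wq : w \in msupp q by rewrite Eq mem_head.
have Iq : I_G q.
  by rewrite /q -[X in g - X]mul1r; apply: toric_subM => //; apply/toric_binomial.
have [w' [w'q w'w Eww]] := toric_partner Iq wq.
have q_red z : z \in msupp q -> z \in msupp g /\ z != u.
  move=> zq; have zu : z != u.
    apply: contraTneq zq => ->.
    by rewrite mcoeff_msupp mcoeffB gu1 mcoeffB !mcoeffX eqxx (negbTE vu) subr0 subrr eqxx.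
  split=> //; have [->//|zv] := eqVneq z v.
  move: zq; rewrite !mcoeff_msupp !mcoeffB !mcoeffX.
  by rewrite (eq_sym u) (eq_sym v) (negbTE zu) (negbTE zv) !subr0.
have [wg wu] := q_red _ wq; have [w'g w'u] := q_red _ w'q.
have [lt_w|lt_w] := orP (lex_lt_total w'w).
  by case: (B_red g u w gB _ wg wu) => //; apply: initial lt_w.
case: (B_red g u w' gB _ w'g w'u) => //; apply: initial lt_w => x.
by rewrite Eww.
Qed.

End Circuits.

(** * Walks of type (iii) *)

Section WalkBinomials.
Variables (K : fieldType) (n m : nat) (adj : rel 'I_n) (e : m.-tuple {set 'I_n}).
Hypotheses (adj_irr : irreflexive adj) (e_uniq : uniq e) (e_edges : e =i edge_set adj).
Local Notation T := {mpoly K[m]}.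

Definition edge_mnm (S : {set 'I_n}) : 'X_{1..m} :=
  (\sum_(k < m | tnth e k == S) U_(k))%MM.

Lemma edge_varE S : edge_var K e S = 'X_[edge_mnm S].
Proof. exact: mprodXE. Qed.

Lemma edeg_edge_mnm S x : S \in e -> edeg e (edge_mnm S) x = (x \in S).
Proof.
move=> /tnthP[k ->]; rewrite /edge_mnm (big_pred1 k) ?edegU // => j.
by apply/eqP/eqP => [|->//]; move/tuple_uniqP: e_uniq => /[apply].
Qed.

Definition edges_mnm (Ss : seq {set 'I_n}) : 'X_{1..m} := (\sum_(S <- Ss) edge_mnm S)%MM.

Lemma walk_binomialE s : walk_binomial K e s =
  'X_[edges_mnm (odd_position_edges s)] - 'X_[edges_mnm (even_position_edges s)].
Proof.
by congr (_ - _); rewrite /edges_mnm -mprodXE; apply: eq_bigr => S _; exact: edge_varE.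
Qed.

Lemma cycle_walk_adj s : cycle adj s -> all (fun p => adj p.1 p.2) (zip s (rot 1 s)).
Proof.
case: s => // x s /=; rewrite rot1_cons -[X in zip X]/(x :: s).
rewrite -[X in zip X](belast_rcons x s x); move: (rcons s x) => t.
by elim: t x => [|y t IH] x //= /andP[-> /IH].
Qed.

(** Each visit to [x] is an end of the edge before it and of the edge after it. *)
Lemma edeg_walk_edges s x : cycle adj s ->
  (edeg e (edges_mnm (odd_position_edges s)) x
   + edeg e (edges_mnm (even_position_edges s)) x = (count_mem x s).*2)%N.
Proof.
move=> cyc; pose D S := edeg e (edge_mnm S) x.
have -> : (edeg e (edges_mnm (odd_position_edges s)) x
   + edeg e (edges_mnm (even_position_edges s)) x = \sum_(S <- walk_edges s) D S)%N.
  have szE : size (walk_edges s) = size s.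
    by rewrite size_map size_zip size_rot minnn.
  rewrite [RHS](big_nth set0) szE /edges_mnm !edeg_sum.
  rewrite /odd_position_edges /even_position_edges !big_map !big_filter.
  by rewrite [RHS](bigID odd) /index_iota subn0 addnC.
rewrite /walk_edges big_map.
rewrite (eq_big_seq (fun p => (p.1 == x) + (p.2 == x))%N) => [|[y z] yz]; last first.
  have /allP/(_ _ yz) /= yz_adj := cycle_walk_adj cyc.
  rewrite /D edeg_edge_mnm; last by rewrite e_edges; apply/imsetP; exists (y, z); rewrite ?inE.
  by rewrite in_edge //; apply: contraTneq yz_adj => ->; rewrite adj_irr.
rewrite big_split /=.
have sum1 (t : seq 'I_n) : (\sum_(y <- t) (y == x) = count_mem x t)%N.
  by rewrite -sum1_count [RHS]big_mkcond; apply: eq_bigr => y _; rewrite /= ; case: eqP.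
rewrite -(big_map fst xpredT (fun y => (y == x) : nat)).
rewrite -(big_map snd xpredT (fun y => (y == x) : nat)).
rewrite !sum1 -/(unzip1 _) -/(unzip2 _) unzip1_zip ?size_rot // unzip2_zip ?size_rot //.
by rewrite (permP (permEl (perm_rot 1 s))) addnn.
Qed.

(** The vertex [x i] starts both the cycle and the path leaving it, so it is visited twice;
    disjointness of consecutive cycles makes [x i] and [x (ordS i)] distinct. *)
Lemma type_iii_count s : type_iii adj s -> exists x y,
  [/\ x != y, 1 < count_mem x s & 1 < count_mem y s]%N.
Proof.
case=> h [x [c [q [k [h_gt0 odd_c path_q dis ->]]]]].
have count_x i : (1 < count_mem (x i)
    (rot k (flatten [seq (x i :: c i) ++ belast (x i) (q i) | i <- enum 'I_h])))%N.
  rewrite (permP (permEl (perm_rot _ _))) count_flatten -map_comp sumnE big_map.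
  rewrite (bigD1_seq i) ?mem_enum ?enum_uniq //= count_cat eqxx.
  by have /and4P[_ _ _] := path_q i; case: (q i) => //= y t _; rewrite eqxx; lia.
pose i := Ordinal h_gt0; exists (x i), (x (ordS i)); split=> //.
have := dis i; rewrite disjoint_has => /hasPn/(_ (x i)); rewrite mem_head => /(_ isT).
by apply: contra => /eqP {1}->; exact: mem_head.
Qed.

(** Equality would make the degrees of [u] the visit counts of [s], but only [a] can have degree
    2. *)
Lemma minimal_binomial_not_type_iii (u v : 'X_{1..m}) a s :
  minimal_binomial e u v -> (forall x, edeg e u x <= 1 + (x == a))%N ->
  cycle adj s -> type_iii adj s ->
  'X_[u] - 'X_[v] <> walk_binomial K e s /\ 'X_[u] - 'X_[v] <> - walk_binomial K e s.
Proof.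
move=> uv_min edeg_u cyc iii; have uv := minimal_binomial_neq uv_min.
have Euv : edeg e u =1 edeg e v by case: uv_min.
set ro := edges_mnm (odd_position_edges s); set re := edges_mnm (even_position_edges s).
have main : (u = ro /\ v = re) \/ (u = re /\ v = ro) -> False.
  move=> Ero; have edeg_s x : edeg e u x = count_mem x s.
    apply: double_inj; rewrite -edeg_walk_edges // -/ro -/re -addnn.
    by case: Ero => -[<- <-]; rewrite -Euv.
  have [x [y [xy]]] := type_iii_count iii; rewrite -!edeg_s.
  have := edeg_u x; have := edeg_u y.
  by case: (eqVneq x a) xy => [->|_ _]; [rewrite eq_sym => /negbTE->|]; lia.
(* Both signs are handled at once, since a nonzero scalar does not change the support. *)
have supp (c : K) : c != 0 -> 'X_[u] - 'X_[v] = c *: walk_binomial K e s -> False.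
  move=> c0 Ec; have ror : ro != re.
    apply: contraNneq (oner_neq0 K) => Er.
    have := mcoeffB u 'X_[u] ('X_[v] : T); rewrite Ec walk_binomialE -/ro -/re Er.
    rewrite subrr scaler0 mcoeff0 !mcoeffX eqxx (eq_sym v) (negbTE uv) subr0.
    by move/esym/eqP.
  have sub w : ((w == u) || (w == v)) = ((w == ro) || (w == re)).
    rewrite -(msupp_binomial K uv) -(msupp_binomial K ror) Ec walk_binomialE.
    by rewrite !mcoeff_msupp mcoeffZ mulf_eq0 (negbTE c0).
  apply: main; have := sub u; have := sub v; rewrite !eqxx orbT /=.
  by move=> /esym/orP[]/eqP Ev /esym/orP[]/eqP Eu; [|right|left|];
    rewrite // Eu Ev eqxx in uv.
split=> [E|E].
  by apply: (supp 1); rewrite ?oner_neq0 // scale1r.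
by apply: (supp (-1)); rewrite ?oppr_eq0 ?oner_neq0 // scaleN1r.
Qed.

End WalkBinomials.

Theorem mainTheorem5 (K : fieldType) (n m : nat) (adj : rel 'I_n)
    (adj_sym : symmetric adj) (adj_irr : irreflexive adj)
    (no_isolated : forall i, exists j, adj i j)
    (e : m.-tuple {set 'I_n}) (e_uniq : uniq e) (e_edges : e =i edge_set adj)
    (lin_res : has_linear_resolution (edge_ideal K adj))
    (lin_quot : linear_quotient_ordering (edge_ideal K adj)
                  [tuple edge_monomial K (tnth e k) | k < m]) :
  (forall B : seq {mpoly K[m]},
     reduced_groebner_basis (@lex_lt m) (toric_ideal K e) B ->
     (forall (g : {mpoly K[m]}) (s : seq 'I_n), g \in B ->
        primitive_walk K adj e s -> type_iii adj s ->
        g <> walk_binomial K e s /\ g <> - walk_binomial K e s)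
     /\ (forall g : {mpoly K[m]}, g \in B -> is_circuit (toric_ideal K e) g))
  /\ (forall p : {mpoly K[m]},
        toric_ideal K e p <-> ideal_gen (is_circuit (toric_ideal K e)) p).
Proof.
have graph_edges (k : 'I_m) : exists x y : 'I_n, x != y /\ tnth e k = [set x; y].
  have := mem_tnth k e; rewrite e_edges => /imsetP[[x y] /= xy ->].
  exists x, y; split=> //; apply: contraTneq xy => ->.
  by rewrite inE /= adj_irr.
have lq := linear_quotients_edges graph_edges e_uniq lin_quot.
split; last exact: toric_ideal_circuits.
move=> B redB; split=> [g s gB [/andP[cyc _] _ _] iii|g gB];
  have [u [v [uv_min ->]]] := reduced_groebner_minimal redB gB.
  have [a edeg_u] := minimal_binomial_edeg_le graph_edges lq uv_min.
  exact: (minimal_binomial_not_type_iii K adj_irr e_uniq e_edges uv_min edeg_u).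
exact: minimal_binomial_circuit.
Qed.
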